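(* Let $n\ge1$ and let $b\ge2$ be even. Then for every integer $\beta$ with $2\le\beta\le 2bn$, the hypercube $Q_{2bn}$ can be decomposed into $bn2^{2bn-\beta}$ cycles of length $2^\beta$.
   Context: $Q_m$ is the $m$-dimensional hypercube: vertex set $\{0,1\}^m$, edges joining vertices that differ in exactly one component. A decomposition of a graph into cycles is a family of cycle subgraphs with pairwise disjoint edge sets whose union is the graph. *)

(* Defs.v *)
From mathcomp Require Import all_boot.

Set Implicit Arguments.
Unset Strict Implicit.
Unset Printing Implicit Defensive.

(* A simple graph on [T] is given by its adjacency relation, a symmetric and
   irreflexive [e : rel T]; the edge joining [x] and [y] is the unordered pair
   [set x; y]. *)
Definition edge_set (T : finType) (e : rel T) : {set {set T}} :=
  [set [set p.1; p.2] | p : T * T & e p.1 p.2].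

Definition cycle_edges (T : finType) (c : seq T) : {set {set T}} :=
  [set [set x; next c x] | x in c].

(* A cycle subgraph has no isolated vertex, so it is determined by its edge
   set [C]; [c] lists its vertices in cyclic order. The bound on the length
   is needed because path.v's [ucycle] also accepts a single edge traversed
   back and forth. *)
Definition is_cycle_subgraph (T : finType) (e : rel T) (k : nat)
    (C : {set {set T}}) : Prop :=
  exists c : seq T,
    [/\ 3 <= size c, size c = k, ucycle e c & C = cycle_edges c].

(* Distinct members of [D] are disjoint, so #|D| is the number of cycles. *)
Definition is_cycle_decomposition (T : finType) (e : rel T) (N k : nat)
    (D : {set {set {set T}}}) : Prop :=
  [/\ partition D (edge_set e), #|D| = N &
      forall C, C \in D -> is_cycle_subgraph e k C].

Definition decomposes_into_cycles (T : finType) (e : rel T) (N k : nat) : Prop :=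
  exists D : {set {set {set T}}}, is_cycle_decomposition e N k D.

Definition hypercube (m : nat) : rel {ffun 'I_m -> bool} :=
  fun u v => #|[set i | u i != v i]| == 1.

Lemma hypercube_sym (m : nat) : symmetric (@hypercube m).
Proof.
by move=> u v; rewrite /hypercube; congr (#|pred_of_set _| == 1); apply/setP=> i;
  rewrite !inE eq_sym.
Qed.

Lemma hypercube_irrefl (m : nat) : irreflexive (@hypercube m).
Proof.
move=> u; rewrite /hypercube; suff -> : [set i | u i != u i] = set0 by rewrite cards0.
by apply/setP=> i; rewrite !inE eqxx.
Qed.

(* Main.v *)
Require Import Defs.
From mathcomp Require Import all_boot.
From mathcomp Require Import zify.

Set Implicit Arguments.
Unset Strict Implicit.
Unset Printing Implicit Defensive.

(** Since [b] is even, the dimension [2bn] is a multiple [4k] of four. Let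
    [N = 4^k], the number of vertices of [Q_2k].

    _Reduction to a torus._ Suppose that [Q_2k] is decomposed into [k]
    Hamiltonian cycles [C_1, ..., C_k]. Then [Q_4k = Q_2k x Q_2k] is the
    edge-disjoint union of the [k] spanning tori [C_i x C_i], each of them the
    [N x N] torus, and it is enough to cut this torus into cycles of length
    [2^beta] ([half_decomposition_exists]). One always cuts it into a family
    [F] of cycles and the family of their transposes, which must use every edge
    between them. There are three families. From [N] on, walks that go [u] steps
    up and [N - u] steps right, over and over, close after [N^2 / u] steps
    ([long_half]). Between [8] and [N / 2], neighbouring staircases with steps
    of size two are joined into ladders at regular distances ([short_half]).
    For length [4] one takes every second square of every second row
    ([squares_half]).

    _Hamiltonian decompositions of even cubes._ They are built by induction,
    multiplying [Q_2r] by a 4-cycle of levels. Let [w] be one of the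
    Hamiltonian cycles of [Q_2r]. The torus [w x C_4] splits into two
    Hamiltonian cycles: [columns], which climbs three edges in every column
    before it steps to the next column, and its complement [helix]. Every other
    Hamiltonian cycle [c] appears in four disjoint copies, one per level, that
    have to be joined. If [ab] is an edge of [c], then the copies of [c] on two
    consecutive levels become one cycle when their copies of [ab] are exchanged
    for the vertical edges above [a] and [b] ([cycle_merge]); [columns] then has
    to live with the copies of [ab] instead of these vertical edges. As
    [columns] climbs all its vertical edges in the same direction, it stays a
    Hamiltonian cycle: the stretch between [a] and [b] is run backwards
    ([path_edge_flip]).

    Each [c] needs three such exchanges, on three different pairs of consecutive
    levels, and exchanges do not disturb each other when their stretches of [w]
    are disjoint. So [w] comes with disjoint stretches reserved for the other
    cycles, the slots ([slot]), and the crux of the induction is that a slot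
    reproduces itself in the next dimension ([slot_step]), while the unreserved
    columns suffice to make a slot for [helix] and still multiply
    ([slotted_step]). The induction starts in [Q_6], where a cycle with room for
    two slots exists that forms a decomposition together with its images under
    the rotation of the three pairs of coordinates ([base_slotted]).

    _Counting._ A family of cycles of length [L] that covers all edges of a
    graph is a decomposition as soon as the sizes add up
    ([decomposes_by_counting]), so it suffices to find every edge on some cycle. *)

(** * Edges of paths and cycles *)

Section Edges.
Variable T : eqType.
Implicit Types (u v w x y z : T) (s c p : seq T).

Definition same_edge u v x y :=
  (x == u) && (y == v) || (x == v) && (y == u).

Fixpoint path_edge z s x y :=
  if s is w :: s' then same_edge z w x y || path_edge w s' x y else false.

Definition cycle_edge c x y :=
  if c is z :: _ then path_edge (last z c) c x y else false.

Lemma same_edgeC u v x y : same_edge u v x y = same_edge v u x y.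
Proof. by rewrite /same_edge orbC. Qed.

Lemma same_edge_sym u v x y : same_edge u v x y = same_edge u v y x.
Proof. by rewrite /same_edge orbC andbC; congr orb; rewrite andbC. Qed.

Lemma same_edge_refl u v : same_edge u v u v.
Proof. by rewrite /same_edge !eqxx. Qed.

Lemma same_edgeP (e : rel T) u v x y :
  symmetric e -> e u v -> same_edge u v x y -> e x y.
Proof. by move=> es euv /orP[]/andP[/eqP-> /eqP->] //; rewrite es. Qed.

Lemma path_edge_cat z s1 s2 x y :
  path_edge z (s1 ++ s2) x y = path_edge z s1 x y || path_edge (last z s1) s2 x y.
Proof. by elim: s1 z => //= w s IH z; rewrite IH orbA. Qed.

Lemma path_edge_rcons z s w x y :
  path_edge z (rcons s w) x y = path_edge z s x y || same_edge (last z s) w x y.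
Proof. by rewrite -cats1 path_edge_cat /= orbF. Qed.

Lemma path_edge_sym z s x y : path_edge z s x y = path_edge z s y x.
Proof. by elim: s z => //= w s IH z; rewrite IH same_edge_sym. Qed.

Lemma path_edge_rev z s w x y :
  path_edge z (rcons s w) x y = path_edge w (rcons (rev s) z) x y.
Proof.
elim: s z => [|a s IH] z /=; first by rewrite same_edgeC.
by rewrite IH rev_cons [RHS]path_edge_rcons last_rcons same_edgeC orbC.
Qed.

Lemma path_edgeP z s x y : path_edge z s x y ->
  exists s1 s2, z :: s = s1 ++ x :: y :: s2 \/ z :: s = s1 ++ y :: x :: s2.
Proof.
elim: s z => //= w s IH z /orP[/orP[]/andP[/eqP-> /eqP->]|].
- by exists [::], s; left.
- by exists [::], s; right.
by case/IH=> s1 [s2 H]; exists (z :: s1), s2; case: H => ->; [left|right].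
Qed.

Lemma path_edge_sub (e : rel T) z s : symmetric e -> path e z s -> subrel (path_edge z s) e.
Proof.
move=> es; elim: s z => //= w s IH z /andP[ezw /IH ps] x y /orP[|/ps //].
exact: same_edgeP.
Qed.

Lemma cycle_edge_sub (e : rel T) c : symmetric e -> cycle e c -> subrel (cycle_edge c) e.
Proof.
by case: c => [_ _ ? ? //|z s] es; rewrite (cycle_path z); apply: path_edge_sub.
Qed.

Lemma cycle_edge_sym c x y : cycle_edge c x y = cycle_edge c y x.
Proof. by case: c => //= z s; rewrite same_edge_sym path_edge_sym. Qed.

Lemma cycle_edge_cons_rcons u p v x y :
  cycle_edge (u :: rcons p v) x y = same_edge u v x y || path_edge u (rcons p v) x y.
Proof. by rewrite /= last_rcons same_edgeC. Qed.

Lemma cycle_edge_catC s1 s2 x y : cycle_edge (s1 ++ s2) x y = cycle_edge (s2 ++ s1) x y.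
Proof.
case: s1 => [|a s1]; first by rewrite cats0.
case: s2 => [|b s2]; first by rewrite cats0.
rewrite /= !last_cat /= !path_edge_cat /=.
by rewrite orbA [RHS]orbA orbC.
Qed.

Lemma cycle_edge_rev c x y : cycle_edge (rev c) x y = cycle_edge c x y.
Proof.
case: c => // a c; case: (lastP c) => // {}c b.
rewrite rev_cons rev_rcons [LHS]/= last_rcons [RHS]cycle_edge_cons_rcons.
by rewrite [in RHS]path_edge_rev.
Qed.

Lemma cycle_edge_open c u v : 1 < size c -> cycle_edge c u v ->
  exists p, perm_eq (u :: rcons p v) c /\
    cycle_edge c =2 cycle_edge (u :: rcons p v).
Proof.
move=> c1 cuv.
suff [a [b [p [Hp [He [[Ea Eb]|[Ea Eb]]]]]]] : exists a b p, perm_eq (a :: rcons p b) c /\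
    cycle_edge c =2 cycle_edge (a :: rcons p b) /\ (a = u /\ b = v \/ a = v /\ b = u).
- by subst a b; exists p.
- subst a b; exists (rev p); split.
    by apply: perm_trans Hp; rewrite perm_sym -(perm_rev (v :: _)) rev_cons rev_rcons perm_refl.
  move=> x y; rewrite He -cycle_edge_rev; congr cycle_edge.
  by rewrite rev_cons rev_rcons.
have core (a b : T) s1 s2 : c = s1 ++ a :: b :: s2 ->
    perm_eq (b :: rcons (s2 ++ s1) a) c /\ cycle_edge c =2 cycle_edge (b :: rcons (s2 ++ s1) a).
  move=> ->; split.
    by rewrite -cat_rcons perm_sym perm_catC /= rcons_cat perm_refl.
  by move=> x y; rewrite -cat_rcons cycle_edge_catC /= rcons_cat.
case: c c1 cuv core => // z s c1 /path_edgeP [s1 [s2]].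
case: s1 => [|w s1] H core.
- case: H => [[E1 E2 E3]|[E1 E2 E3]]; subst.
    case: (lastP s2) c1 core => // p b _ _; exists v, b, p.
    by rewrite last_rcons; do 2 split => //; right.
  case: (lastP s2) c1 core => // p b _ _; exists u, b, p.
  by rewrite last_rcons; do 2 split => //; left.
- by case: H => [[_ /core]|[_ /core]] [H1 H2];
    [exists v, u, (s2 ++ s1) | exists u, v, (s2 ++ s1)]; do 2 split => //; [right|left].
Qed.

(** Cut the first cycle open at [uv] and the second one at [u'v']; the two
    paths, the second one run backwards, close up through [vv'] and [u'u]. *)
Lemma cycle_merge c1 c2 u v u' v' :
  1 < size c1 -> 1 < size c2 -> cycle_edge c1 u v -> cycle_edge c2 u' v' ->
  exists c, [/\ perm_eq c (c1 ++ c2), cycle_edge c u u', cycle_edge c v v' &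
   [/\ forall x y, cycle_edge c1 x y -> cycle_edge c x y || same_edge u v x y,
       forall x y, cycle_edge c2 x y -> cycle_edge c x y || same_edge u' v' x y &
       forall x y, cycle_edge c x y ->
        [|| cycle_edge c1 x y, cycle_edge c2 x y, same_edge u u' x y | same_edge v v' x y]]].
Proof.
move=> s1 s2 /(cycle_edge_open s1)[p [pc1 e1]] /(cycle_edge_open s2)[q [pc2 e2]].
have E x y : cycle_edge ((u :: rcons p v) ++ v' :: rcons (rev q) u') x y =
   [|| same_edge u u' x y, same_edge v v' x y, path_edge u (rcons p v) x y
     | path_edge u' (rcons q v') x y].
  rewrite cat_cons /= last_cat /= last_rcons path_edge_cat /= last_rcons -path_edge_rev.
  by rewrite (same_edgeC u'); congr orb; rewrite orbCA.
exists ((u :: rcons p v) ++ v' :: rcons (rev q) u'); split.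
- apply: perm_cat => //; apply: perm_trans pc2.
  by rewrite perm_sym -(perm_rev (u' :: _)) rev_cons rev_rcons perm_refl.
- by rewrite E same_edge_refl.
- by rewrite E same_edge_refl orbT.
split=> x y; rewrite ?e1 ?e2 E ?cycle_edge_cons_rcons.
- by case/orP=> ->; rewrite ?orbT.
- by case/orP=> ->; rewrite ?orbT.
- by case/or4P=> ->; rewrite ?orbT.
Qed.

(** Two edges [uu'] and [vv'] that a path traverses in the same direction can
    be exchanged for [uv] and [u'v']: only the stretch from [u'] to [v] is run
    backwards, and the result is again a path through the same vertices. *)
Lemma path_edge_flip z p u u' s v v' g :
  let old := path_edge z (rcons p u ++ (u' :: rcons s v) ++ v' :: g) in
  let new := path_edge z (rcons p u ++ rev (u' :: rcons s v) ++ v' :: g) in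
  [/\ forall x y, new x y -> [|| old x y, same_edge u v x y | same_edge u' v' x y],
      forall x y, old x y -> [|| new x y, same_edge u u' x y | same_edge v v' x y],
      new u v & new u' v'].
Proof.
have Eo x y : path_edge z (rcons p u ++ (u' :: rcons s v) ++ v' :: g) x y =
   [|| path_edge z (rcons p u) x y, path_edge u' (rcons s v) x y || path_edge v' g x y,
       same_edge u u' x y | same_edge v v' x y].
  rewrite path_edge_cat last_rcons /= path_edge_cat /= last_rcons.
  by congr orb; do 4 case: (_ x y).
have En x y : path_edge z (rcons p u ++ rev (u' :: rcons s v) ++ v' :: g) x y =
   [|| path_edge z (rcons p u) x y, path_edge u' (rcons s v) x y || path_edge v' g x y,
       same_edge u v x y | same_edge u' v' x y].
  rewrite path_edge_cat last_rcons rev_cons rev_rcons /= path_edge_cat /= last_rcons.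
  by rewrite -path_edge_rev; congr orb; do 4 case: (_ x y).
split; last 2 first.
- by rewrite En same_edge_refl !orbT.
- by rewrite En same_edge_refl !orbT.
- by move=> x y; rewrite Eo En => /or4P[] ->; rewrite ?orbT.
- by move=> x y; rewrite Eo En => /or4P[] ->; rewrite ?orbT.
Qed.

End Edges.

Lemma cycle_edge_map (T U : eqType) (f : T -> U) (c : seq T) x y : injective f ->
  cycle_edge (map f c) (f x) (f y) = cycle_edge c x y.
Proof.
move=> inj.
have pm z s : path_edge (f z) (map f s) (f x) (f y) = path_edge z s x y.
  by elim: s z => //= w s IH z; rewrite IH /same_edge !(inj_eq inj).
by case: c => // z c; rewrite /= last_map pm /same_edge !(inj_eq inj).
Qed.

(** * The product with a 4-cycle *)

(** The vertices of a 4-cycle, coded as those of the square [Q_2], so that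
    multiplying by it adds two dimensions to a cube; [up] is the Gray code. *)
Definition level := (bool * bool)%type.
Definition up (l : level) : level := (l.2, ~~ l.1).
Definition down (l : level) : level := (~~ l.2, l.1).

Notation L0 := ((false, false) : level).
Notation L1 := ((false, true) : level).
Notation L2 := ((true, true) : level).
Notation L3 := ((true, false) : level).

Definition level_edge (l m : level) := (m == up l) || (l == up m).

Lemma level_edgeC : symmetric level_edge.
Proof. by move=> l m; rewrite /level_edge orbC. Qed.

Definition cart (T U : eqType) (e : rel T) (f : rel U) : rel (T * U) :=
  fun p q => e p.1 q.1 && (p.2 == q.2) || (p.1 == q.1) && f p.2 q.2.

Lemma cart_sym (T U : eqType) (e : rel T) (f : rel U) :
  symmetric e -> symmetric f -> symmetric (cart e f).
Proof. by move=> es fs p q; rewrite /cart es fs (eq_sym p.1) (eq_sym p.2). Qed.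

Notation times_level e := (cart e level_edge).

Lemma times_level_sym (T : eqType) (e : rel T) : symmetric e -> symmetric (times_level e).
Proof. by move=> es; apply: cart_sym => //; apply: level_edgeC. Qed.

Lemma iter_down n l : iter n down l = iter (n %% 4) down l.
Proof.
rewrite {1}(divn_eq n 4) addnC iterD; congr iter.
by elim: (n %/ 4) => // k IH; rewrite mulSn iterD IH; case: (l) => [[] []].
Qed.

Section Columns.
Variable T : eqType.
Implicit Types (x y : T) (s c : seq T) (l : level).

Definition column l x := [:: (x, l); (x, up l); (x, up (up l)); (x, down l)].

(** The path climbs three edges in the column of [x] and steps to the next
    column at the level it has reached, which is one level below its start. *)
Fixpoint columns l s : seq (T * level) :=
  if s is x :: s' then column l x ++ columns (down l) s' else [::].

Lemma columns_cat l s1 s2 :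
  columns l (s1 ++ s2) = columns l s1 ++ columns (iter (size s1) down l) s2.
Proof. by elim: s1 l => //= x s IH l; rewrite IH -iterSr. Qed.

Lemma columns_rcons l s x :
  columns l (rcons s x) = columns l s ++ column (iter (size s) down l) x.
Proof. by rewrite -cats1 columns_cat. Qed.

Lemma size_columns l s : size (columns l s) = 4 * size s.
Proof. by elim: s l => //= x s IH l; rewrite IH mulnS. Qed.

Lemma mem_columns l s x m : ((x, m) \in columns l s) = (x \in s).
Proof.
elim: s l => // y s IH l; rewrite [columns _ _]/= -[_ :: _]/(column l y ++ _) mem_cat IH inE.
by congr orb; rewrite !inE !xpair_eqE; case: eqP => //= _; case: l m {IH} => [[] []] [[] []].
Qed.

Lemma columns_uniq l s : uniq s -> uniq (columns l s).
Proof.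
elim: s l => // x s IH l /andP[xs us].
rewrite [columns _ _]/= -[_ :: _]/(column l x ++ _) cat_uniq IH // andbT.
apply/andP; split.
  by rewrite /= !inE !xpair_eqE eqxx; case: l => [[] []].
by apply/hasPn=> -[y m]; rewrite mem_columns !inE !xpair_eqE => ys; case: eqP xs => // <-; rewrite ys.
Qed.

Definition layer l s : seq (T * level) := [seq (x, l) | x <- s].

Definition layers s := layer L0 s ++ layer L1 s ++ layer L2 s ++ layer L3 s.

Lemma path_edge_layer l z s x y m n :
  path_edge (z, l) (layer l s) (x, m) (y, n) = [&& m == l, n == l & path_edge z s x y].
Proof.
elim: s z => [|w s IH] z /=; first by rewrite !andbF.
rewrite IH /same_edge !xpair_eqE /=.
by case: (m == l); case: (n == l); rewrite /= ?andbF ?andbT ?orbF.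
Qed.

Lemma cycle_edge_layer l c x y m n :
  cycle_edge (layer l c) (x, m) (y, n) = [&& m == l, n == l & cycle_edge c x y].
Proof.
case: c => [|z c]; first by rewrite /= !andbF.
rewrite -path_edge_layer /cycle_edge /layer map_cons.
by rewrite -[(z, l) :: _]/([seq (x, l) | x <- z :: c]) /= last_map.
Qed.

(** The copies of [c] on the levels [1] and [2] are joined along [ab], the copy
    on level [3] is added along [a'b'] and the copy on level [0] along [a''b''].
    These edges of [c] are disjoint, so each of them is still there when its
    turn comes. *)
Lemma layers_merge c a b a' b' a'' b'' :
  1 < size c -> uniq [:: a; b; a'; b'; a''; b''] ->
  cycle_edge c a b -> cycle_edge c a' b' -> cycle_edge c a'' b'' ->
  exists c' : seq (T * level), [/\ perm_eq c' (layers c),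
   forall p q, cycle_edge c' p q -> times_level (cycle_edge c) p q,
   [/\ cycle_edge c' (a, L1) (a, L2), cycle_edge c' (b, L1) (b, L2),
       cycle_edge c' (a', L2) (a', L3), cycle_edge c' (b', L2) (b', L3) &
       cycle_edge c' (a'', L0) (a'', L1) /\ cycle_edge c' (b'', L0) (b'', L1)] &
   forall l x y, cycle_edge c x y ->
     [|| cycle_edge c' (x, l) (y, l), same_edge (a, L1) (b, L1) (x, l) (y, l),
         same_edge (a, L2) (b, L2) (x, l) (y, l), same_edge (a', L2) (b', L2) (x, l) (y, l),
         same_edge (a', L3) (b', L3) (x, l) (y, l), same_edge (a'', L0) (b'', L0) (x, l) (y, l)
       | same_edge (a'', L1) (b'', L1) (x, l) (y, l)]].
Proof.
move=> c1 uab cab ca'b' ca''b''.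
have [a'a a'b [a''a a''b]] : [/\ a' != a, a' != b & a'' != a /\ a'' != b].
  by split; last split; apply/eqP=> E; move: uab; rewrite E /= !inE eqxx ?orbT ?andbF.
have sl l : 1 < size (layer l c) by rewrite size_map.
have el l x y : cycle_edge c x y -> cycle_edge (layer l c) (x, l) (y, l).
  by rewrite cycle_edge_layer !eqxx.
have [d [pd da db [dl dr de]]] := cycle_merge (sl L1) (sl L2) (el L1 _ _ cab) (el L2 _ _ cab).
have sd : 1 < size d by rewrite (perm_size pd) size_cat ltn_addr.
have da'b' : cycle_edge d (a', L2) (b', L2).
  case/orP: (dr _ _ (el L2 _ _ ca'b')) => //.
  by rewrite /same_edge !xpair_eqE (negPf a'a) (negPf a'b).
have [f [pf fa fb [fl fr fe]]] := cycle_merge sd (sl L3) da'b' (el L3 _ _ ca'b').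
have sf : 1 < size f by rewrite (perm_size pf) size_cat ltn_addr.
have fa''b'' : cycle_edge f (a'', L1) (b'', L1).
  case/orP: (dl _ _ (el L1 _ _ ca''b'')) => [/fl/orP[]//|].
    by rewrite /same_edge !xpair_eqE /= !andbF.
  by rewrite /same_edge !xpair_eqE (negPf a''a) (negPf a''b).
have [g [pg ga gb [gl gr ge]]] := cycle_merge (sl L0) sf (el L0 _ _ ca''b'') fa''b''.
exists g; split.
- rewrite (permPl pg) perm_cat2l (permPl pf) /layers catA perm_cat2r.
  exact: pd.
- have lay l p q : cycle_edge (layer l c) p q -> times_level (cycle_edge c) p q.
    case: p q => [x m] [y n]; rewrite cycle_edge_layer /cart /= => /and3P[/eqP-> /eqP-> ->].
    by rewrite eqxx.
  have ver x l m p q : same_edge (x, l) (x, m) p q -> level_edge l m ->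
      times_level (cycle_edge c) p q.
    move=> /orP[]/andP[/eqP-> /eqP->] lm; rewrite /cart /= eqxx /=.
      by rewrite lm orbT.
    by rewrite level_edgeC lm orbT.
  move=> p q /ge/or4P[/lay//|/fe|/ver->//|/ver->//].
  move=> /or4P[/de|/lay//|/ver->//|/ver->//].
  by move=> /or4P[/lay//|/lay//|/ver->//|/ver->//].
- split=> //.
  + by case/orP: (fl _ _ da) => [/gr/orP[]//|]; rewrite /same_edge !xpair_eqE /= ?andbF.
  + by case/orP: (fl _ _ db) => [/gr/orP[]//|]; rewrite /same_edge !xpair_eqE /= ?andbF.
  + by case/orP: (gr _ _ fa) => //; rewrite /same_edge !xpair_eqE /= ?andbF.
  + by case/orP: (gr _ _ fb) => //; rewrite /same_edge !xpair_eqE /= ?andbF.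
have dg p q : cycle_edge d p q -> [|| cycle_edge g p q, same_edge (a', L2) (b', L2) p q
    | same_edge (a'', L1) (b'', L1) p q].
  by move=> /fl/orP[/gr/orP[]->|->]; rewrite ?orbT.
move=> l x y cxy; have {}el := el _ _ _ cxy.
case: l => [[] []].
- by case/orP: (dr _ _ (el L2)) => [/dg/or3P[]->|->]; rewrite ?orbT.
- by case/orP: (fr _ _ (el L3)) => [/gr/orP[]->|->]; rewrite ?orbT.
- by case/orP: (dl _ _ (el L1)) => [/dg/or3P[]->|->]; rewrite ?orbT.
- by case/orP: (gl _ _ (el L0)) => ->; rewrite ?orbT.
Qed.

End Columns.

(** * Slots and their reproduction *)

(** Three disjoint stretches of a path whose ends are joined by an edge of [E],
    reserved for the exchanges between the levels [1]-[2], [2]-[3] and [0]-[1].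
    If a slot starts at level [0], then by these lengths [a], [b], [a'], [b'],
    [a''] and [b''] start at the levels [0], [1], [0], [1], [0] and [3]. As a
    column lacks only the edge that leads up to its start, both ends of each
    stretch do have the vertical edges that they are to give away. The part [z]
    makes the length of a slot divisible by four, so that the next slot starts
    at level [0] again. *)
Definition slot (T : eqType) (E : rel T) (s : seq T) : Prop :=
  exists a m b a' m' b' a'' m'' b'' z,
  [/\ s = (a :: rcons m b) ++ (a' :: rcons m' b') ++ (a'' :: rcons m'' b'') ++ z,
      [/\ E a b, E a' b' & E a'' b''] &
      [/\ size m %% 4 = 2, size m' %% 4 = 2, size m'' %% 4 = 0 & size z %% 4 = 2]].

Lemma slot_size (T : eqType) (E : rel T) (s : seq T) : slot E s -> size s %% 4 = 0.
Proof.
case=> a [m [b [a' [m' [b' [a'' [m'' [b'' [z [-> _ [sm sm' sm'' sz]]]]]]]]]]].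
rewrite !size_cat /= !size_rcons; lia.
Qed.

Section SlotStep.
Variable T : eqType.

(** The three exchanges between the columns over a slot of [c] and the layers of
    [c] produce a joined cycle [c'] and a path that is again a slot, now for
    [c']. The first two stretches keep their ends, and the edge between these
    ends at level [0] survives in [c']. The third one now ends in the two
    vertices of the vertical edge that it has handed over to [c']. *)
Lemma slot_step (c s : seq T) : 1 < size c -> uniq s -> slot (cycle_edge c) s ->
  exists s' c' : seq (T * level), [/\ slot (cycle_edge c') s',
    [/\ perm_eq s' (columns L0 s), perm_eq c' (layers c) &
        forall z, last z s' = last z (columns L0 s)],
    forall p q, cycle_edge c' p q -> times_level (cycle_edge c) p q,
    forall z p q, path_edge z s' p q ->
      path_edge z (columns L0 s) p q || times_level (cycle_edge c) p q &
    (forall z p q, path_edge z (columns L0 s) p q -> path_edge z s' p q || cycle_edge c' p q)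
    /\ (forall z l x y, cycle_edge c x y ->
      path_edge z s' (x, l) (y, l) || cycle_edge c' (x, l) (y, l))].
Proof.
move=> c1 us [a [m [b [a' [m' [b' [a'' [m'' [b'' [t [Es [cab cab' cab''] [sm sm' sm'' st]]]]]]]]]]]].
have uab : uniq [:: a; b; a'; b'; a''; b''].
  apply: subseq_uniq us; rewrite Es.
  have sub (x y : T) r : subseq [:: x; y] (x :: rcons r y).
    by rewrite /= eqxx -cats1 suffix_subseq.
  rewrite -[X in subseq X _]/([:: a; b] ++ [:: a'; b'] ++ [:: a''; b''] ++ [::]).
  by do 3 (apply: cat_subseq; first exact: sub); exact: sub0seq.
have [c' [pc' vc' [ea eb ea' eb' [ea'' eb'']] cov]] := layers_merge c1 uab cab cab' cab''.
(* [M1], [M2] and [M3] are the stretches to be reversed. *)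
pose M1 := (a, L2) :: rcons ((a, L3) :: columns L3 m) (b, L1).
pose M2 := (a', L3) :: rcons (columns L3 m' ++ [:: (b', L1)]) (b', L2).
pose X3 := rcons ((a'', L2) :: (a'', L3) :: columns L3 m'' ++ [:: (b'', L3)]) (b'', L0).
pose M3 := (a'', L1) :: X3.
pose A1 := rcons [:: (a, L0)] (a, L1).
pose A2 := rcons [:: (a', L0); (a', L1)] (a', L2).
pose A3 := rcons [::] (a'', L0).
pose D1 := (b, L2) :: [:: (b, L3); (b, L0)].
pose D2 := (b', L3) :: [:: (b', L0)].
pose D3 := (b'', L1) :: (b'', L2) :: columns L2 t.
pose tt N1 N2 N3 := A1 ++ N1 ++ D1 ++ A2 ++ N2 ++ D2 ++ A3 ++ N3 ++ D3.
have Ecol : columns L0 s = tt M1 M2 M3.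
  have cp (l : level) (x y : T) r q : columns l ((x :: rcons r y) ++ q) =
     column l x ++ columns (down l) r ++ column (iter ((size r).+1 %% 4) down l) y ++
       columns (iter ((size r).+2 %% 4) down l) q.
    rewrite -!iter_down columns_cat [columns l _]/= columns_rcons -!iterSr /= size_rcons.
    by rewrite -!catA.
  have [s1 s1' s1''] : [/\ (size m).+1 %% 4 = 3, (size m').+1 %% 4 = 3 & (size m'').+1 %% 4 = 1].
    by clear -sm sm' sm''; split; lia.
  have [s2 s2' s2''] : [/\ (size m).+2 %% 4 = 0, (size m').+2 %% 4 = 0 & (size m'').+2 %% 4 = 2].
    by clear -sm sm' sm''; split; lia.
  rewrite Es cp s1 s2 cp s1' s2' cp s1'' s2''.
  rewrite /tt /A1 /A2 /A3 /M1 /M2 /M3 /X3 /D1 /D2 /D3 /=.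
  by rewrite -!cats1 /= -?catA /= -?catA.
pose s' := tt (rev M1) (rev M2) (rev M3).
have flip1 := path_edge_flip _ [:: (a, L0)] (a, L1) (a, L2) ((a, L3) :: columns L3 m) (b, L1)
   (b, L2) ([:: (b, L3); (b, L0)] ++ A2 ++ M2 ++ D2 ++ A3 ++ M3 ++ D3).
have flip2 := path_edge_flip _ (A1 ++ rev M1 ++ D1 ++ [:: (a', L0); (a', L1)]) (a', L2) (a', L3)
   (columns L3 m' ++ [:: (b', L1)]) (b', L2) (b', L3) ([:: (b', L0)] ++ A3 ++ M3 ++ D3).
have flip3 := path_edge_flip _ (A1 ++ rev M1 ++ D1 ++ A2 ++ rev M2 ++ D2) (a'', L0) (a'', L1)
   ((a'', L2) :: (a'', L3) :: columns L3 m'' ++ [:: (b'', L3)]) (b'', L0) (b'', L1)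
   ((b'', L2) :: columns L2 t).
rewrite -/M1 -/M2 -/M3 -/D1 -/D2 -/D3 in flip1 flip2 flip3.
have {}flip1 z : let old := path_edge z (tt M1 M2 M3) in let new := path_edge z (tt (rev M1) M2 M3) in
   [/\ forall p q, new p q -> [|| old p q, same_edge (a, L1) (b, L1) p q | same_edge (a, L2) (b, L2) p q],
      forall p q, old p q -> [|| new p q, same_edge (a, L1) (a, L2) p q | same_edge (b, L1) (b, L2) p q],
      new (a, L1) (b, L1) & new (a, L2) (b, L2)] by exact: flip1.
have {}flip2 z : let old := path_edge z (tt (rev M1) M2 M3) in let new := path_edge z (tt (rev M1) (rev M2) M3) in
   [/\ forall p q, new p q -> [|| old p q, same_edge (a', L2) (b', L2) p q | same_edge (a', L3) (b', L3) p q],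
      forall p q, old p q -> [|| new p q, same_edge (a', L2) (a', L3) p q | same_edge (b', L2) (b', L3) p q],
      new (a', L2) (b', L2) & new (a', L3) (b', L3)].
  by have := flip2 z; rewrite !rcons_cat -!catA.
have {}flip3 z : let old := path_edge z (tt (rev M1) (rev M2) M3) in let new := path_edge z s' in
   [/\ forall p q, new p q -> [|| old p q, same_edge (a'', L0) (b'', L0) p q | same_edge (a'', L1) (b'', L1) p q],
      forall p q, old p q -> [|| new p q, same_edge (a'', L0) (a'', L1) p q | same_edge (b'', L0) (b'', L1) p q],
      new (a'', L0) (b'', L0) & new (a'', L1) (b'', L1)].
  by have := flip3 z; rewrite !rcons_cat -!catA.
have sc' u v p q : same_edge u v p q -> cycle_edge c' u v -> cycle_edge c' p q.
  by move=> uv cuv; apply: same_edgeP uv => // x y; rewrite cycle_edge_sym.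
(* What a reversal removes is vertical and belongs to [c']. *)
have keep2 z p q : path_edge z (tt (rev M1) (rev M2) M3) p q -> path_edge z s' p q || cycle_edge c' p q.
  have [_ H _ _] := flip3 z; by case/H/or3P=> [->|/sc' H'|/sc' H']; rewrite ?H' ?orbT.
have keep1 z p q : path_edge z (tt (rev M1) M2 M3) p q -> path_edge z s' p q || cycle_edge c' p q.
  have [_ H _ _] := flip2 z; by case/H/or3P=> [/keep2//|/sc' H'|/sc' H']; rewrite ?H' ?orbT.
have keep0 z p q : path_edge z (tt M1 M2 M3) p q -> path_edge z s' p q || cycle_edge c' p q.
  have [_ H _ _] := flip1 z; by case/H/or3P=> [/keep1//|/sc' H'|/sc' H']; rewrite ?H' ?orbT.
have c'0 x y : cycle_edge c x y -> x \in [:: a; b; a'; b'] -> cycle_edge c' (x, L0) (y, L0).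
  move=> cxy xi; have := cov L0 _ _ cxy; rewrite /same_edge !xpair_eqE /= !andbF !andbT !orbF.
  case/orP=> //= /orP[]/andP[/eqP E _]; move: xi uab; rewrite E !inE.
    by case/or4P=> /eqP->; rewrite /= !inE eqxx ?orbT ?andbF.
  by case/or4P=> /eqP->; rewrite /= !inE eqxx ?orbT ?andbF.
exists s', c'; split=> //.
- exists (a, L0), ((a, L1) :: rev M1 ++ [:: (b, L2); (b, L3)]), (b, L0).
  exists (a', L0), [:: (a', L1), (a', L2) & rev M2 ++ [:: (b', L3)]], (b', L0).
  exists (a'', L0), (rev X3), (a'', L1), D3; split.
  + rewrite /s' /tt /A1 /A2 /A3 /D1 /D2 /M3 rev_cons /=.
    by rewrite -!cats1 -!catA.
  + by rewrite !c'0 // !inE eqxx ?orbT.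
  + rewrite /M1 /M2 /X3 /D3 /= !(size_cat, size_rev, size_rcons, size_columns) /= !(size_cat, size_rcons, size_columns) /=.
    clear -sm sm' sm'' st; split; lia.
- split=> //.
    by rewrite Ecol /s' /tt; do 3 (rewrite ?perm_cat2l; apply: perm_cat; first by rewrite perm_rev).
  by move=> z; rewrite Ecol /s' /tt !last_cat.
- move=> z p q; rewrite Ecol.
  have tl l x y p' q' : same_edge (x, l) (y, l) p' q' -> cycle_edge c x y -> times_level (cycle_edge c) p' q'.
    move=> xy cxy; apply: same_edgeP xy; last by rewrite /cart /= cxy eqxx.
    by apply: times_level_sym => ? ?; rewrite cycle_edge_sym.
  have [H3 _ _ _] := flip3 z; have [H2 _ _ _] := flip2 z; have [H1 _ _ _] := flip1 z.
  case/H3/or3P=> [|/tl->|/tl->]; rewrite ?orbT //.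
  case/H2/or3P=> [|/tl->|/tl->]; rewrite ?orbT //.
  by case/H1/or3P=> [->|/tl->|/tl->]; rewrite ?orbT.
split=> z.
  by move=> p q; rewrite Ecol => /keep0.
have sp u v p q : same_edge u v p q -> path_edge z s' u v || cycle_edge c' u v ->
    path_edge z s' p q || cycle_edge c' p q.
  pose E p q := path_edge z s' p q || cycle_edge c' p q.
  have sE : symmetric E by move=> x y; rewrite /E cycle_edge_sym path_edge_sym.
  by move=> uv suv; apply: (@same_edgeP _ E u v).
have [_ _ k1 k2] := flip1 z; have [_ _ k3 k4] := flip2 z; have [_ _ k5 k6] := flip3 z.
move=> l x y /(cov l)/orP[->|]; first by rewrite orbT.
case/or4P=> [/sp|/sp|/sp|/or3P[/sp|/sp|/sp]]; apply.
- exact: keep1 k1.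
- exact: keep1 k2.
- exact: keep2 k3.
- exact: keep2 k4.
- by rewrite k5.
- by rewrite k6.
Qed.

End SlotStep.

(** * Cycles given by periodic functions *)

Section Walks.
Variable T : eqType.

Lemma path_edge_map_iota (f : nat -> T) k n x y :
  path_edge (f k) (map f (iota k.+1 n)) x y =
  has (fun t => same_edge (f t) (f t.+1) x y) (iota k n).
Proof. by elim: n k => //= n IH k; rewrite IH. Qed.

Lemma cycle_edge_mkseq (f : nat -> T) n x y : f n = f 0 ->
  cycle_edge (mkseq f n) x y = has (fun t => same_edge (f t) (f t.+1) x y) (iota 0 n).
Proof.
case: n => // n fn.
have -> : has (fun t => same_edge (f t) (f t.+1) x y) (iota 0 n.+1) =
    has (fun t => same_edge (f t) (f t.+1) x y) (iota 0 n) || same_edge (f n) (f n.+1) x y.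
  by rewrite -[in iota 0 _]addn1 iotaD has_cat /= orbF.
rewrite /mkseq /cycle_edge /= path_edge_map_iota orbC fn; congr (_ || same_edge _ _ _ _).
by rewrite last_map -nth_last size_iota; case: n {fn} => // n; rewrite nth_iota.
Qed.

Lemma cycle_edge_walk (f : nat -> T) n t : 0 < n -> (forall t, f (t + n) = f t) ->
  cycle_edge (mkseq f n) (f t) (f t.+1).
Proof.
move=> n0 per.
have perm t' : f (t' %% n) = f t'.
  rewrite {2}(divn_eq t' n) addnC; elim: (t' %/ n) => [|k IH]; first by rewrite addn0.
  by rewrite mulSn addnCA addnC per.
rewrite cycle_edge_mkseq; last by rewrite -(per 0).
apply/hasP; exists (t %% n); first by rewrite mem_iota ltn_mod.
by rewrite perm -(perm (t %% n).+1) -addn1 modnDml addn1 perm same_edge_refl.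
Qed.

Lemma columns_mkseq (f : nat -> T) n :
  columns L0 (mkseq f n) =
  mkseq (fun t => (f (t %/ 4), iter (t %% 4) up (iter (t %/ 4) down L0))) (4 * n).
Proof.
elim: n => // n IH; rewrite mkseqS columns_rcons size_mkseq IH mulnSr addn4 !mkseqS.
rewrite -!cats1 -!catA; congr (_ ++ _) => /=; rewrite /column.
have d k : k < 4 -> (4 * n + k) %/ 4 = n /\ (4 * n + k) %% 4 = k by lia.
have [] := d 0 isT; rewrite addn0 => -> ->.
have [] := d 1 isT; rewrite addn1 => -> ->.
have [] := d 2 isT; rewrite addn2 => -> ->.
have [] := d 3 isT; rewrite addn3 => -> -> /=.
by do 3 congr cons; congr [:: (_, _)]; case: (iter n down L0) => [[] []].
Qed.

End Walks.

Section Periodic.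
Variables (T : eqType) (x0 : T) (w : seq T).
Hypothesis w0 : 0 < size w.

Definition cnth i := nth x0 w (i %% size w).

Lemma cnth_mod i j : i = j %[mod size w] -> cnth i = cnth j.
Proof. by rewrite /cnth => ->. Qed.

Lemma mkseq_cnth : w = mkseq cnth (size w).
Proof.
apply: (@eq_from_nth _ x0); rewrite ?size_mkseq // => i iN.
by rewrite nth_mkseq // /cnth modn_small.
Qed.

Lemma cnthP x : x \in w -> exists2 i, i < size w & x = cnth i.
Proof. by case/(nthP x0)=> i iN <-; exists i; rewrite // /cnth modn_small. Qed.

Lemma cnth_step i : cycle_edge w (cnth i) (cnth i.+1).
Proof. by rewrite mkseq_cnth; apply: cycle_edge_walk => // t; apply: cnth_mod; rewrite modnDr. Qed.

Lemma cnth_edgeP x y : cycle_edge w x y -> exists2 i, i < size w & same_edge (cnth i) (cnth i.+1) x y.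
Proof.
rewrite {1}mkseq_cnth cycle_edge_mkseq; last by apply: cnth_mod; rewrite modnn mod0n.
by case/hasP=> i; rewrite mem_iota => /andP[_ iN] H; exists i.
Qed.

End Periodic.

(** * Two Hamiltonian cycles of the product of a cycle and a 4-cycle *)

Section Helix.
Variables (T : eqType) (x0 : T) (w : seq T).
Let N := size w.
Hypotheses (N4 : N %% 4 = 0) (N3 : N %% 3 = 1) (uw : uniq w).
Let N0 : 0 < N. Proof. by move: N3; case: N. Qed.
Notation cnth := (cnth x0 w).

(** The level at which [columns] enters column [i]. *)
Definition lev i := iter i down L0.

Lemma lev_mod i j : i = j %[mod 4] -> lev i = lev j.
Proof. by rewrite /lev => H; rewrite iter_down H -iter_down. Qed.

Lemma up_lev i : up (lev i.+1) = lev i.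
Proof. by rewrite /lev iterS; case: (iter i down L0) => [[] []]. Qed.

Lemma lev_exists i l : exists2 o, o < 4 & l = lev (i + o).
Proof.
exists (index l (traject down (lev i) 4)).
  rewrite -[X in _ < X](size_traject down (lev i)) index_mem.
  by case: (lev i) => [[] []]; case: l => [[] []].
by rewrite [RHS]/lev addnC iterD -/(lev i); case: (lev i) => [[] []]; case: l => [[] []].
Qed.

Let cover t := (cnth (t %/ 4), iter (t %% 4) up (lev (t %/ 4))).

Lemma columnsE : columns L0 w = mkseq cover (4 * N).
Proof. by rewrite {1}(mkseq_cnth x0 w) columns_mkseq. Qed.

Lemma cover_period t : cover (t + 4 * N) = cover t.
Proof.
rewrite /cover addnC mulnC divnMDl // modnMDl.
congr (_, iter _ _ _); first by apply: cnth_mod; rewrite modnDl.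
by apply: lev_mod; rewrite -modnDml N4.
Qed.

Lemma times_cycle_sym : symmetric (times_level (cycle_edge w)).
Proof. by apply: times_level_sym => x y; rewrite cycle_edge_sym. Qed.

Lemma columns_valid p q : cycle_edge (columns L0 w) p q -> times_level (cycle_edge w) p q.
Proof.
rewrite columnsE cycle_edge_mkseq; last exact: (cover_period 0).
case/hasP=> t _; apply: same_edgeP; first exact: times_cycle_sym.
rewrite (divn_eq t 4) mulnC; move: (t %/ 4) (t %% 4) (ltn_pmod t (isT : 0 < 4)) => i o o4; rewrite /cover -addnS.
have -> : (4 * i + o) %/ 4 = i by lia.
have -> : (4 * i + o) %% 4 = o by lia.
case: (ltngtP o 3) => [o3|ge|->]; last 2 first.
- by lia.
- have -> : (4 * i + 4) %/ 4 = i.+1 by lia.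
  have -> : (4 * i + 4) %% 4 = 0 by lia.
  by rewrite /cart /= (cnth_step _ N0) /lev /=; case: (iter i down L0) => [[] []].
have -> : (4 * i + o.+1) %/ 4 = i by lia.
have -> : (4 * i + o.+1) %% 4 = o.+1 by lia.
by rewrite /cart /= eqxx /level_edge /= eqxx orbT.
Qed.

Lemma columns_horizontal i :
  cycle_edge (columns L0 w) (cnth i, lev i.+1) (cnth i.+1, lev i.+1).
Proof.
have := @cycle_edge_walk _ cover (4 * N) (4 * i + 3) _ cover_period.
rewrite -columnsE muln_gt0 N0 => /(_ isT); rewrite /cover.
have -> : (4 * i + 3) %/ 4 = i by lia.
have -> : (4 * i + 3) %% 4 = 3 by lia.
have -> : (4 * i + 3).+1 %/ 4 = i.+1 by lia.
have -> : (4 * i + 3).+1 %% 4 = 0 by lia.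
have -> : iter 3 up (lev i) = lev i.+1 by rewrite -up_lev; case: (lev i.+1) => [[] []].
by [].
Qed.

Lemma columns_vertical i l : l != lev i.+1 ->
  cycle_edge (columns L0 w) (cnth i, l) (cnth i, up l).
Proof.
move=> ne.
have [o o3 El] : exists2 o, o < 3 & l = iter o up (lev i).
  have [o o4 El] := lev_exists i l; rewrite El in ne *.
  case: o o4 ne {El} => [|[|[|[|//]]]] _; rewrite ?addn1 ?eqxx // => _.
  - by exists 0; rewrite // addn0.
  - by exists 2 => //; rewrite addn2 /lev /=; case: (iter i down L0) => [[] []].
  - by exists 1 => //; rewrite addn3 /lev /=; case: (iter i down L0) => [[] []].
have := @cycle_edge_walk _ cover (4 * N) (4 * i + o) _ cover_period.
rewrite -columnsE muln_gt0 N0 => /(_ isT); rewrite /cover.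
have -> : (4 * i + o) %/ 4 = i by lia.
have -> : (4 * i + o) %% 4 = o by lia.
have -> : (4 * i + o).+1 %/ 4 = i by lia.
have -> : (4 * i + o).+1 %% 4 = o.+1 by lia.
by rewrite El.
Qed.

(** The complement of [columns] walks along a level for three steps, up to the
    column where [columns] uses the next edge of this level, and climbs the one
    edge that [columns] leaves out there. The next run starts in that column. *)
Let runs t := (cnth (3 * (t %/ 4) + t %% 4), lev (3 * (t %/ 4))).

Lemma runs_period t : runs (t + 4 * N) = runs t.
Proof.
rewrite /runs [t + _]addnC [4 * N]mulnC divnMDl // modnMDl mulnDr; congr (_, _).
  by apply: cnth_mod; rewrite -addnA modnMDl.
by apply: lev_mod; rewrite -modnDml -modnMmr N4.
Qed.

(** The number [N] of columns is prime to [3], so a run starts in each column.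
    Hence column [i] is met by one that started [o] columns earlier. *)
Lemma runs_at i o : o < 4 -> exists j,
  (forall k, k < 4 - o -> runs (4 * j + o + k) = (cnth (i + k), lev (i + (4 - o)))) /\
  runs (4 * j + 4) = (cnth (i + (3 - o)), lev (i + (3 - o))).
Proof.
move=> o4.
have [j [K E]] : exists j K, 3 * j + o = i + N * K.
  (* [2 * (N %/ 3) + 1] is the inverse of [3] modulo [N]. *)
  exists ((2 * (N %/ 3) + 1) * (i + N - o)), (1 + 2 * (i + N - o)).
  have [M EN] : exists M, N = 3 * M + 1 by exists (N %/ 3); lia.
  have -> : N %/ 3 = M by lia.
  have ioN : o <= i + N by move: N4 N0; lia.
  by nia.
have [M EN] : exists M, N = 4 * M by exists (N %/ 4); lia.
exists j; split=> [k ko|]; rewrite /runs.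
  have -> : (4 * j + o + k) %/ 4 = j by lia.
  have -> : (4 * j + o + k) %% 4 = o + k by lia.
  congr (_, _).
    by apply: cnth_mod; rewrite addnA E addnAC [N * K]mulnC addnC modnMDl.
  by apply: lev_mod; move: E; rewrite EN; lia.
have -> : (4 * j + 4) %/ 4 = j.+1 by lia.
have -> : (4 * j + 4) %% 4 = 0 by lia.
have {}E : 3 * j.+1 + 0 = K * N + (i + (3 - o)) by lia.
congr (_, _).
  by apply: cnth_mod; rewrite E modnMDl.
by apply: lev_mod; move: E; rewrite EN; lia.
Qed.

Definition helix := mkseq runs (4 * N).

Lemma helix_step t : cycle_edge helix (runs t) (runs t.+1).
Proof. by apply: cycle_edge_walk; rewrite ?muln_gt0 //; apply: runs_period. Qed.

Lemma helix_vertical i : cycle_edge helix (cnth i, lev i) (cnth i, lev i.+1).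
Proof.
have [j [/(_ 0 isT) Hj Hj']] := @runs_at i 3 isT; have := helix_step (4 * j + 3).
by rewrite -addnS Hj' -[4 * j + 3]addn0 Hj !addn0 addn1 cycle_edge_sym.
Qed.

Lemma helix_horizontal i l : l != lev i.+1 -> cycle_edge helix (cnth i, l) (cnth i.+1, l).
Proof.
have [o o4 ->] := lev_exists i.+1 l; rewrite addSnnS.
case: o o4 => [_|o o4 _]; first by rewrite addn1 eqxx.
have [|j [Hj _]] := @runs_at i (2 - o); first by lia.
have := helix_step (4 * j + (2 - o)).
have /Hj : 0 < 4 - (2 - o) by lia.
have /Hj : 1 < 4 - (2 - o) by lia.
have -> : i + (4 - (2 - o)) = i + o.+2 by lia.
by rewrite !addn0 !addn1 => -> ->.
Qed.

Lemma helix_mem x l : x \in w -> (x, l) \in helix.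
Proof.
case/(cnthP x0)=> i iN ->; have [o o4 ->] := lev_exists i l.
have [|j [/(_ 0) Hj _]] := @runs_at i ((4 - o) %% 4); first by rewrite ltn_mod.
have {}Hj : runs (4 * j + (4 - o) %% 4) = (cnth i, lev (i + o)).
  rewrite -[X in runs X]addn0 Hj ?addn0; last by lia.
  by congr (_, _); apply: lev_mod; lia.
rewrite -Hj; have -> : runs (4 * j + (4 - o) %% 4) = runs ((4 * j + (4 - o) %% 4) %% (4 * N)).
  rewrite {1}(divn_eq (4 * j + (4 - o) %% 4) (4 * N)); elim: (_ %/ _) => // k IH.
  by rewrite mulSn -addnA addnC runs_period.
by apply/mapP; eexists; last reflexivity; rewrite mem_iota ltn_mod muln_gt0 N0.
Qed.

Lemma size_helix : size helix = 4 * N.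
Proof. exact: size_mkseq. Qed.

(** Its [4 * N] steps visit all [4 * N] vertices over [w]. *)
Lemma helix_uniq : uniq helix.
Proof.
apply: (@leq_size_uniq _ (columns L0 w)).
- exact: columns_uniq.
- by move=> [x l]; rewrite mem_columns => /helix_mem.
- by rewrite size_helix size_columns.
Qed.

Lemma helix_valid p q : cycle_edge helix p q -> times_level (cycle_edge w) p q.
Proof.
rewrite cycle_edge_mkseq; last exact: (runs_period 0).
case/hasP=> t _; apply: same_edgeP; first exact: times_cycle_sym.
rewrite (divn_eq t 4) mulnC; move: (t %/ 4) (t %% 4) (ltn_pmod t (isT : 0 < 4)) => j o o4; rewrite /runs -addnS.
have -> : (4 * j + o) %/ 4 = j by lia.
have -> : (4 * j + o) %% 4 = o by lia.
case: (ltngtP o 3) => [o3|ge|->]; last 2 first.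
- by lia.
- have -> : (4 * j + 4) %/ 4 = j.+1 by lia.
  have -> : (4 * j + 4) %% 4 = 0 by lia.
  rewrite mulnSr addn0 /cart eqxx /= addn3 /level_edge.
  by rewrite -[lev (3 * j)]up_lev -[lev _.+1]up_lev -[lev _.+2]up_lev; case: (lev _) => [[] []]; rewrite ?orbT.
have -> : (4 * j + o.+1) %/ 4 = j by lia.
have -> : (4 * j + o.+1) %% 4 = o.+1 by lia.
by rewrite /cart /= eqxx addnS (cnth_step _ N0).
Qed.

End Helix.

(** * Hamiltonian decompositions with slots *)

Definition hamiltonian (T : finType) (e : rel T) (c : seq T) : Prop :=
  [/\ uniq c, size c = #|T| & subrel (cycle_edge c) e].

(** A Hamiltonian decomposition in which the first cycle lists the slots [p.1]
    of all the other cycles [p.2], followed by unreserved vertices. *)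
Definition slotted (T : finType) (e : rel T) (ps : seq (seq T * seq T)) (free : seq T) : Prop :=
  let w := flatten (unzip1 ps) ++ free in
  [/\ hamiltonian e w,
      forall p, p \in ps -> hamiltonian e p.2 /\ slot (cycle_edge p.2) p.1,
      size free %% 4 = 0 &
      forall x y, e x y -> cycle_edge w x y || has (fun c => cycle_edge c x y) (unzip2 ps)].

Lemma hamiltonian_mem (T : finType) (e : rel T) (c : seq T) x : hamiltonian e c -> x \in c.
Proof.
move=> [uc sc _]; have [||_ ->] := @uniq_min_size _ c (enum T) uc; rewrite ?mem_enum //.
- by move=> t _; rewrite mem_enum.
- by rewrite -cardE sc.
Qed.

Section Step.
Variables (T : finType) (e : rel T).

Lemma card_times_level : #|{: T * level}| = 4 * #|T|.
Proof. by rewrite card_prod card_prod card_bool mulnC. Qed.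

Lemma times_level_sub (f : rel T) : subrel f e -> subrel (times_level f) (times_level e).
Proof. by move=> fe p q /orP[/andP[/fe H1 H2]|H]; apply/orP; [left; rewrite H1|right]. Qed.

Lemma slots_size (ps : seq (seq T * seq T)) :
  (forall p, p \in ps -> hamiltonian e p.2 /\ slot (cycle_edge p.2) p.1) ->
  size (flatten (unzip1 ps)) %% 4 = 0.
Proof.
elim: ps => // p ps IH H; rewrite /= size_cat.
have [_ /slot_size E] := H p (mem_head _ _).
rewrite -modnDm E IH // => q qp; apply: H; exact: mem_behead.
Qed.

(** A slot starts at level [0], and its new path keeps the last vertex of the
    columns over it, so the slots do not interfere. *)
Lemma slots_step (ps : seq (seq T * seq T)) : 1 < #|T| ->
  uniq (flatten (unzip1 ps)) ->
  (forall p, p \in ps -> hamiltonian e p.2 /\ slot (cycle_edge p.2) p.1) ->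
  exists ps' : seq (seq (T * level) * seq (T * level)),
  let S := columns L0 (flatten (unzip1 ps)) in let S' := flatten (unzip1 ps') in
  let kept := fun p q => has (fun c => cycle_edge c p q) (unzip2 ps') in
  [/\ size ps' = size ps /\
      (forall p, p \in ps' -> hamiltonian (times_level e) p.2 /\ slot (cycle_edge p.2) p.1),
      perm_eq S' S /\ (forall z, last z S' = last z S),
      forall z p q, path_edge z S' p q -> path_edge z S p q || times_level e p q,
      forall z p q, path_edge z S p q -> path_edge z S' p q || kept p q &
      forall z l x y, has (fun c => cycle_edge c x y) (unzip2 ps) ->
        path_edge z S' (x, l) (y, l) || kept (x, l) (y, l)].
Proof.
move=> T1; elim: ps => [|[s c] ps IH] /=.
  by exists [::]; split=> // ? ? ?.
rewrite cat_uniq => /and3P[us _ ups] H.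
have [ps' [[sz Hps'] [pS lS] v1 k1 k2]] := IH ups (fun p pi => H p (mem_behead (s := _ :: _) pi)).
have [/= [uc sc ec] slc] := H (s, c) (mem_head _ _).
have c1 : 1 < size c by rewrite sc.
have [s' [c' [slc' [pS' pc' lS'] ec' v1' [k1' k2']]]] := slot_step c1 us slc.
have s4 := slot_size slc.
have colE : columns L0 (s ++ flatten (unzip1 ps)) = columns L0 s ++ columns L0 (flatten (unzip1 ps)).
  by rewrite columns_cat iter_down s4.
exists ((s', c') :: ps') => /=; rewrite colE; split.
- split=> [|p]; first by rewrite sz.
  rewrite inE => /orP[/eqP->|/Hps'//] /=; split=> //; split.
  + rewrite (perm_uniq pc') /layers !cat_uniq !has_cat !negb_or.
    rewrite !map_inj_uniq ?uc; try by move=> ? ? [].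
    by do !(apply/andP; split) => //; apply/hasPn=> -[x m] /mapP[z _ [_ ->]]; apply/mapP=> -[t _ []].
  + rewrite (perm_size pc') !size_cat !size_map sc card_times_level; lia.
  + by move=> p' q' /ec'; apply: times_level_sub.
- by split=> [|z]; rewrite ?last_cat ?lS' ?lS //; apply: perm_cat.
- move=> z p q; rewrite !path_edge_cat lS' => /orP[/v1'/orP[->//|]|/v1/orP[->|->]]; rewrite ?orbT //.
  by move/(times_level_sub ec) ->; rewrite !orbT.
- move=> z p q; rewrite !path_edge_cat lS' => /orP[/k1'/orP[->//|->]|/k1/orP[->|->]]; rewrite ?orbT //.
- move=> z l x y; rewrite path_edge_cat => /orP[/(k2' z l)/orP[->|->]|/(k2 (last z s') l)/orP[->|->]];
   by rewrite ?orbT.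
Qed.

Lemma cycle_edge_cat_last (V : eqType) (s f : seq V) y : f != [::] ->
  cycle_edge (s ++ f) =2 path_edge (last y f) (s ++ f).
Proof. by case: s => [|a s]; case: f => // b f _ p q; rewrite /cycle_edge /= last_cat. Qed.

(** The first four free columns become a slot for [helix]: it contains the
    vertical edge that [columns] leaves out in each of the first two, and a
    horizontal edge between the other two. *)
Lemma slotted_step ps free : #|T| %% 4 = 0 -> #|T| %% 3 = 1 -> 4 <= size free ->
  slotted e ps free ->
  exists ps' free', [/\ slotted (times_level e) ps' free',
    size ps' = (size ps).+1 & size free' = 4 * (size free - 4)].
Proof.
move=> T4 T3; case: free => [|y0 [|y1 [|y2 [|y3 rest]]]] // _ [[uw sw ew] Hps fm cov].
set free := [:: y0, y1, y2, y3 & rest] in uw sw ew cov fm *.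
have T1 : 1 < #|T| by clear -T4 T3; case: #|T| T4 T3 => // [[|n]].
set Z := flatten (unzip1 ps) in uw sw ew cov; set w := Z ++ free in uw sw ew cov.
have uZ : uniq Z by move: uw; rewrite cat_uniq => /and3P[].
have Z4 : size Z %% 4 = 0 := slots_size Hps.
have [ps1 /= [[sz1 Hps1] [pS lS] v1 k1 k2]] := slots_step T1 uZ Hps.
set S' := flatten (unzip1 ps1) in pS lS v1 k1 k2.
rewrite -/Z in pS lS v1 k1 k2.
have wN4 : size w %% 4 = 0 by rewrite sw.
have wN3 : size w %% 3 = 1 by rewrite sw.
pose A := helix y0 w.
pose slotA := columns L0 [:: y0; y1; y2; y3].
pose F := columns L0 free.
have colE : columns L0 w = columns L0 Z ++ F by rewrite columns_cat iter_down Z4.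
have Fn : F != [::] by [].
have ccE : cycle_edge (columns L0 w) =2 path_edge (last (y0, L0) F) (columns L0 Z ++ F).
  rewrite colE; exact: cycle_edge_cat_last.
have cwE : cycle_edge (S' ++ F) =2 path_edge (last (y0, L0) F) (S' ++ F).
  exact: cycle_edge_cat_last.
have we : subrel (times_level (cycle_edge w)) (times_level e) := times_level_sub ew.
have hA : hamiltonian (times_level e) A.
  split; first exact: (helix_uniq _ wN4 wN3 uw).
    by rewrite size_helix card_times_level sw.
  by move=> p q /(helix_valid wN4 wN3 uw) /we.
have atZ i : i < size free -> cnth y0 w (size Z + i) = nth y0 free i.
  move=> il; rewrite /cnth modn_small ?size_cat ?ltn_add2l //.
  by rewrite nth_cat ltnNge leq_addr /= addKn.
have levZ i : lev (size Z + i) = lev i by apply: lev_mod; rewrite -modnDml Z4.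
have slA : slot (cycle_edge A) slotA.
  exists (y0, L0), [:: (y0, L1); (y0, L2)], (y0, L3).
  exists (y1, L3), [:: (y1, L0); (y1, L1)], (y1, L2).
  exists (y2, L2), [:: (y2, L3); (y2, L0); (y2, L1); (y3, L1)], (y3, L2), [:: (y3, L3); (y3, L0)].
  split=> //.
  have V i : i < size free -> cycle_edge A (nth y0 free i, lev i) (nth y0 free i, lev i.+1).
    by move=> il; rewrite -atZ // -levZ -[lev i.+1]levZ addnS; exact: (helix_vertical y0 wN4 wN3 uw).
  split; first exact: (V 0); first exact: (V 1).
  have := @helix_horizontal _ y0 w wN4 wN3 uw (size Z + 2) L2.
  by rewrite -addnS atZ // atZ // levZ; apply.
exists (rcons ps1 (slotA, A)), (columns L0 rest).
have wE : flatten (unzip1 (rcons ps1 (slotA, A))) ++ columns L0 rest = S' ++ F.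
  by rewrite /unzip1 map_rcons -cats1 flatten_cat -catA.
have hasE p q : has (fun c => cycle_edge c p q) (unzip2 (rcons ps1 (slotA, A))) =
    has (fun c => cycle_edge c p q) (unzip2 ps1) || cycle_edge A p q.
  by rewrite /unzip2 map_rcons has_rcons orbC.
have kw p q : cycle_edge (columns L0 w) p q ->
    cycle_edge (S' ++ F) p q || has (fun c => cycle_edge c p q) (unzip2 ps1).
  rewrite ccE cwE !path_edge_cat lS => /orP[/k1/orP[->//|->]|->]; by rewrite !orbT.
split; last by rewrite size_columns /= !subSS subn0.
  rewrite /slotted wE; split.
  - split.
    + rewrite (perm_uniq (_ : perm_eq _ (columns L0 w))) ?columns_uniq //.
      by rewrite colE perm_cat2r.
    + by rewrite size_cat (perm_size pS) -size_cat -colE size_columns card_times_level sw.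
    + move=> p q; rewrite cwE path_edge_cat lS.
      case/orP=> [/v1/orP[H|//]|H]; apply/we/(columns_valid y0 wN4 wN3 uw); rewrite ccE path_edge_cat H ?orbT //.
  - by move=> p; rewrite mem_rcons inE => /orP[/eqP->|/Hps1].
  - by rewrite size_columns mulnC modnMl.
  move=> [x l] [y m]; rewrite hasE; set G := _ || _.
  have G1 : cycle_edge (columns L0 w) (x, l) (y, m) -> G.
    by move=> /kw/orP[H|H]; rewrite /G H ?orbT.
  have G2 : cycle_edge A (x, l) (y, m) -> G by move=> H; rewrite /G H !orbT.
  have colA p q : cycle_edge (columns L0 w) p q \/ cycle_edge A p q -> p = (x, l) -> q = (y, m) -> G.
    by move=> H Ep Eq; move: H; rewrite Ep Eq => -[/G1|/G2].
  case/orP=> /andP[/=].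
    move=> /cov/orP[/(cnth_edgeP y0)[i iN xy] /eqP Elm|/(k2 (last (y0, L0) F) l) H /eqP Elm]; last first.
      by rewrite /G -Elm cwE path_edge_cat; case/orP: H => ->; rewrite ?orbT.
    have H : cycle_edge (columns L0 w) (cnth y0 w i, l) (cnth y0 w i.+1, l) \/
        cycle_edge A (cnth y0 w i, l) (cnth y0 w i.+1, l).
      have [->|ne] := eqVneq l (lev i.+1); [left|right].
        exact: columns_horizontal.
      exact: helix_horizontal.
    case/orP: xy => /andP[/eqP-> /eqP->] in colA *; first by apply: colA H _ _; rewrite // Elm.
    by rewrite cycle_edge_sym [cycle_edge A _ _]cycle_edge_sym in H; apply: colA H _ _; rewrite // Elm.
  have vert z k : cycle_edge (columns L0 w) (z, k) (z, up k) \/ cycle_edge A (z, k) (z, up k).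
    have /(cnthP y0)[i iN ->] : z \in w by apply: (@hamiltonian_mem _ e).
    have [->|ne] := eqVneq k (lev i.+1); [right|left].
      by rewrite up_lev cycle_edge_sym; apply: helix_vertical.
    exact: columns_vertical.
  move=> /eqP Exy /orP[]/eqP Elm.
    by apply: colA (vert x l) _ _; rewrite // Exy Elm.
  have H := vert x m; rewrite cycle_edge_sym [cycle_edge A _ _]cycle_edge_sym in H.
  by apply: colA H _ _; rewrite ?Elm // Exy.
by rewrite size_rcons sz1.
Qed.

End Step.

(** * Hypercubes as products *)

Section Cubes.

Definition distance n (u v : {ffun 'I_n -> bool}) := \sum_i (u i != v i : nat).

Lemma hypercubeE n (u v : {ffun 'I_n -> bool}) : hypercube u v = (distance u v == 1).
Proof.
by rewrite /hypercube /distance -sum1dep_card big_mkcond.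
Qed.

Lemma distance_eq0 n (u v : {ffun 'I_n -> bool}) : (distance u v == 0) = (u == v).
Proof.
rewrite /distance sum_nat_eq0; apply/forallP/eqP=> [H|-> i]; last by rewrite eqxx.
by apply/ffunP=> i; have := H i; rewrite /= eqb0 negbK => /eqP.
Qed.

Definition cube_iso (T : finType) (e : rel T) n : Prop :=
  exists2 g : T -> {ffun 'I_n -> bool}, bijective g & forall x y, hypercube (g x) (g y) = e x y.

Lemma card_cube (T : finType) (e : rel T) n : cube_iso e n -> #|T| = 2 ^ n.
Proof. by case=> g /bij_eq_card -> _; rewrite card_ffun card_bool card_ord. Qed.

Lemma cube_iso_cart (T U : finType) (e : rel T) (f : rel U) m n :
  cube_iso e m -> cube_iso f n -> cube_iso (cart e f) (m + n).
Proof.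
move=> [g [g' gK g'K] ge] [h [h' hK h'K] hf].
pose j (p : T * U) : {ffun 'I_(m + n) -> bool} := [ffun i : 'I_(m + n) =>
   match split i with inl a => g p.1 a | inr b => h p.2 b end].
pose j' (w : {ffun 'I_(m + n) -> bool}) :=
  (g' [ffun a => w (lshift n a)], h' [ffun b => w (rshift m b)]).
have jl p a : j p (lshift n a) = g p.1 a by rewrite ffunE -[lshift n a]/(unsplit (inl a)) unsplitK.
have jr p b : j p (rshift m b) = h p.2 b by rewrite ffunE -[rshift m b]/(unsplit (inr b)) unsplitK.
exists j.
  exists j' => [[x y]|w]; rewrite /j'.
    congr (_, _); [rewrite -[RHS]gK|rewrite -[RHS]hK]; congr (_ _); apply/ffunP=> i.
      by rewrite ffunE jl.
    by rewrite ffunE jr.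
  apply/ffunP=> i; rewrite ffunE /= -{2}(splitK i); case: (split i) => k /=.
    by rewrite g'K ffunE.
  by rewrite h'K ffunE.
move=> p q; rewrite hypercubeE.
have -> : distance (j p) (j q) = distance (g p.1) (g q.1) + distance (h p.2) (h q.2).
  rewrite /distance big_split_ord /=; congr (_ + _); apply: eq_bigr => i _.
    by rewrite !jl.
  by rewrite !jr.
rewrite /cart -ge -hf !hypercubeE -(inj_eq (can_inj hK)) -(inj_eq (can_inj gK)) -!distance_eq0.
by case: (distance _ _) => [|[|a]]; case: (distance _ _) => [|[|b]].
Qed.

Lemma cube_iso_level : cube_iso level_edge 2.
Proof.
exists (fun l : level => [ffun i : 'I_2 => if i == ord0 then l.1 else l.2]).
  exists (fun u : {ffun 'I_2 -> bool} => (u ord0, u ord_max)) => [[a b]|u]; first by rewrite !ffunE.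
  by apply/ffunP=> -[[|[|//]] i2]; rewrite ffunE /=; congr (u _); apply: val_inj.
move=> l m; rewrite hypercubeE /distance !big_ord_recl big_ord0 !ffunE /= addn0.
by move: l m => [[] []] [[] []].
Qed.

End Cubes.

(** * Hamiltonian decompositions of even hypercubes *)

Definition hamiltonian_decomposition (T : finType) (e : rel T) (cs : seq (seq T)) : Prop :=
  (forall c, c \in cs -> hamiltonian e c) /\
  (forall x y, e x y -> has (fun c => cycle_edge c x y) cs).

Lemma slotted_decomposition (T : finType) (e : rel T) ps free : slotted e ps free ->
  hamiltonian_decomposition e ((flatten (unzip1 ps) ++ free) :: unzip2 ps).
Proof.
move=> [hw hp _ cov]; split=> [c|x y /cov //].
by rewrite inE => /orP[/eqP->//|/mapP[p /hp[hp2 _] ->]].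
Qed.

Lemma slotI (T : eqType) x0 (E : rel T) p p' p'' z :
  [/\ size p %% 4 = 0, size p' %% 4 = 0, size p'' %% 4 = 2 & size z %% 4 = 2] ->
  0 < size p -> 0 < size p' ->
  [/\ E (head x0 p) (last x0 p), E (head x0 p') (last x0 p') & E (head x0 p'') (last x0 p'')] ->
  slot E (p ++ p' ++ p'' ++ z).
Proof.
have open s : 1 < size s -> exists m, s = head x0 s :: rcons m (last x0 s) /\ size s = (size m).+2.
  case: s => // a s; case: (lastP s) => // m b _; exists m.
  by rewrite /= last_rcons size_rcons.
move=> [s s' s'' sz] p0 p'0 [E1 E2 E3].
have [|m [Em sm]] := open p; first by lia.
have [|m' [Em' sm']] := open p'; first by lia.
have [|m'' [Em'' sm'']] := open p''; first by lia.
exists (head x0 p), m, (last x0 p), (head x0 p'), m', (last x0 p').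
exists (head x0 p''), m'', (last x0 p''), z; split=> //; first by rewrite -Em -Em' -Em''.
by split; lia.
Qed.

Section Base.

Definition base_vertex (n : nat) : level * level * level :=
  ((odd n, odd (n %/ 2)), (odd (n %/ 4), odd (n %/ 8)), (odd (n %/ 16), odd (n %/ 32))).

(** [base_slot1], [base_slot2] and [base_free] list a Hamiltonian cycle of [Q_6]
    that contains one edge from each of the 64 orbits of edges under
    [rotate_pairs]. They are a slot for its first image, a slot for its second
    image, and twelve free vertices. *)
Definition base_slot1 := map base_vertex
  ([:: 38; 54; 50; 34] ++ [:: 32; 48; 56; 60; 52; 36; 44; 12; 4; 20; 16; 0] ++
   [:: 8; 10; 14; 46; 62; 58; 26; 30; 28; 24] ++ [:: 25; 17]).
Definition base_slot2 := map base_vertex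
  ([:: 21; 53; 49; 51; 59; 57; 61; 29] ++ [:: 13; 5; 7; 3; 19; 27; 31; 15] ++
   [:: 11; 43; 42; 40; 41; 9] ++ [:: 1; 33]).
Definition base_free := map base_vertex
  [:: 35; 39; 37; 45; 47; 63; 55; 23; 22; 18; 2; 6].

Definition rotate_pairs (v : level * level * level) : level * level * level :=
  (v.2, v.1.1, v.1.2).

Definition base_cycle := base_slot1 ++ base_slot2 ++ base_free.

Let e6 := times_level (times_level level_edge).

Lemma base_mem v : v \in base_cycle.
Proof. by move: v => [[[[] []] [[] []]] [[] []]]; vm_compute. Qed.

Lemma rotate_pairs_edge v v' : e6 (rotate_pairs v) (rotate_pairs v') = e6 v v'.
Proof.
move: v v' => [[a b] d] [[a' b'] d']; rewrite /e6 /cart /= !xpair_eqE.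
by do 3 case: (_ == _); do 3 case: (level_edge _ _).
Qed.

Lemma rotate_pairsK v : rotate_pairs (rotate_pairs (rotate_pairs v)) = v.
Proof. by move: v => [[]]. Qed.

Lemma rotate_pairs_inj : injective rotate_pairs.
Proof. by move=> x y E; rewrite -[x]rotate_pairsK E rotate_pairsK. Qed.

Lemma rotate_hamiltonian c : hamiltonian e6 c -> hamiltonian e6 (map rotate_pairs c).
Proof.
move=> [uc sc ec]; split.
- by rewrite map_inj_uniq //; apply: rotate_pairs_inj.
- by rewrite size_map.
move=> x y; rewrite -[x]rotate_pairsK -[y]rotate_pairsK rotate_pairs_edge.
by rewrite cycle_edge_map; [apply: ec | apply: rotate_pairs_inj].
Qed.

Lemma base_hamiltonian : hamiltonian e6 base_cycle.
Proof.
split; first by vm_compute.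
  by rewrite !card_prod card_bool.
apply: cycle_edge_sub; last by vm_compute.
by do 2 apply: times_level_sym; apply: level_edgeC.
Qed.

Let covered c x y := has (fun c => cycle_edge c x y)
  [:: c; map rotate_pairs c; map rotate_pairs (map rotate_pairs c)].

Lemma covered_sym c x y : covered c x y = covered c y x.
Proof. by apply: eq_has => d; apply: cycle_edge_sym. Qed.

Lemma covered_rotate c x y : covered c (rotate_pairs x) (rotate_pairs y) = covered c x y.
Proof.
have rI := rotate_pairs_inj.
have cE : c = map rotate_pairs (map rotate_pairs (map rotate_pairs c)).
  by rewrite -!map_comp map_id_in // => v _; apply: rotate_pairsK.
rewrite /covered /= !orbF [in cycle_edge c (rotate_pairs x)]cE !cycle_edge_map //.
by rewrite orbC -orbA.
Qed.

(** Up to rotation, only the edges in the first pair of directions have to be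
    found on one of the three cycles. *)
Lemma base_slotted : slotted e6 [:: (base_slot1, map rotate_pairs base_cycle);
   (base_slot2, map rotate_pairs (map rotate_pairs base_cycle))] base_free.
Proof.
split.
- exact: base_hamiltonian.
- move=> p; rewrite !inE => /orP[/eqP->|/eqP->]; split.
  + exact/rotate_hamiltonian/base_hamiltonian.
  + rewrite /base_slot1 !map_cat; apply: (slotI (x0 := (L0, L0, L0))); by vm_compute.
  + exact/rotate_hamiltonian/rotate_hamiltonian/base_hamiltonian.
  + rewrite /base_slot2 !map_cat; apply: (slotI (x0 := (L0, L0, L0))); by vm_compute.
- by [].
suff cov x y : e6 x y -> covered base_cycle x y by [].
have cov0 a a' b d : level_edge a a' -> covered base_cycle (a, b, d) (a', b, d).
  have C v : covered base_cycle v (up v.1.1, v.1.2, v.2).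
    have /allP : all (fun v => covered base_cycle v (up v.1.1, v.1.2, v.2)) base_cycle by vm_compute.
    by apply; apply: base_mem.
  move=> /orP[]/eqP->; first exact: (C (a, b, d)).
  by rewrite covered_sym; apply: (C (a', b, d)).
move: x y => [[a b] d] [[a' b'] d'] /orP[]/andP[/=].
  move=> /orP[]/andP[/=].
    by move=> aa /eqP-> /eqP->; apply: cov0.
  by move=> /eqP-> bb /eqP->; rewrite -covered_rotate -covered_rotate; apply: cov0.
by move=> /eqP[-> ->] dd; rewrite -covered_rotate; apply: cov0.
Qed.

End Base.

Lemma pow4_mod k : 0 < k -> 2 ^ (2 * k) %% 4 = 0 /\ 2 ^ (2 * k) %% 3 = 1.
Proof.
rewrite expnM; case: k => // k _; split; first by rewrite expnS modnMr.
by rewrite -modnXm exp1n.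
Qed.

(** With [f] free vertices there are [4 * (f - 4)] at the next stage, which
    stays at least [8] from [f = 8] on. *)
Lemma slotted_cube k : 2 < k -> exists (T : finType) (e : rel T) ps free,
  [/\ symmetric e, cube_iso e (2 * k), slotted e ps free, (size ps).+1 = k & 8 <= size free].
Proof.
elim: k => // k IH; rewrite ltnS leq_eqVlt => /orP[/eqP<-|/IH].
  exists (level * level * level : finType)%type, (times_level (times_level level_edge)).
  eexists; eexists; split; last 3 first.
  - exact: base_slotted.
  - by [].
  - by [].
  - by do 2 apply: times_level_sym; apply: level_edgeC.
  - exact: (cube_iso_cart (cube_iso_cart cube_iso_level cube_iso_level) cube_iso_level).
move=> [T [e [ps [free [es iso sl sz f8]]]]].
have [T4 T3] : #|T| %% 4 = 0 /\ #|T| %% 3 = 1.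
  by rewrite (card_cube iso); apply: pow4_mod; rewrite -sz.
have [|ps' [free' [sl' sz' f']]] := slotted_step T4 T3 _ sl; first exact: leq_trans f8.
exists (T * level : finType)%type, (times_level e), ps', free'; split=> //.
- exact: times_level_sym.
- by rewrite mulnSr; apply: cube_iso_cart => //; apply: cube_iso_level.
- by rewrite sz' sz.
- by rewrite f'; lia.
Qed.

(** The square alone has just enough free vertices for one step, to [Q_4]. *)
Lemma level_slotted : slotted level_edge [::] [:: L0; L1; L2; L3].
Proof.
split=> //; first split=> //.
- by rewrite card_prod card_bool.
- by apply: cycle_edge_sub; first exact: level_edgeC.
- by move=> [[] []] [[] []].
Qed.

Theorem cube_hamiltonian_decomposition k : 0 < k ->
  exists (T : finType) (e : rel T) cs, [/\ symmetric e, cube_iso e (2 * k), size cs = k &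
    hamiltonian_decomposition e cs].
Proof.
case: k => // -[_|[_|k _]].
- exists (level : finType), level_edge; eexists; split; last exact: slotted_decomposition level_slotted.
  + exact: level_edgeC.
  + exact: cube_iso_level.
  + by [].
- have [|||ps [free [sl sz _]]] := @slotted_step _ level_edge _ _ _ _ _ level_slotted.
  + by rewrite card_prod card_bool.
  + by rewrite card_prod card_bool.
  + by [].
  exists (level * level : finType)%type, (times_level level_edge); eexists.
  split; last exact: slotted_decomposition sl.
  + by apply: times_level_sym; apply: level_edgeC.
  + exact: cube_iso_cart cube_iso_level cube_iso_level.
  + by rewrite /= size_map sz.
have [T [e [ps [free [es iso sl sz _]]]]] := @slotted_cube k.+3 isT.
exists T, e; eexists; split; last exact: slotted_decomposition sl; rewrite ?es //.
by rewrite /= size_map sz.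
Qed.

(** * Cutting a square torus into cycles of equal length *)

Definition same_point N (p q : nat * nat) :=
  (p.1 == q.1 %[mod N]) && (p.2 == q.2 %[mod N]).

Definition torus_step N (p q : nat * nat) :=
  same_point N (p.1.+1, p.2) q || same_point N (p.1, p.2.+1) q.

Definition torus_edge N p q := torus_step N p q || torus_step N q p.

Definition joins N (p q a b : nat * nat) :=
  same_point N p a && same_point N q b || same_point N p b && same_point N q a.

(** [S] closed walks of length [L] on the torus of side [N] that visit every
    vertex and, together with their transposes, use every edge. By symmetry it
    suffices to find each vertical edge on a walk or on a transposed one. As
    [S * L = N * N], no vertex is visited twice. *)
Definition half_decomposition N L S (f : nat -> nat -> nat * nat) : Prop :=
  [/\ S * L = N * N,
      forall s, s < S -> same_point N (f s L) (f s 0),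
      forall s t, s < S -> t < L -> torus_edge N (f s t) (f s t.+1),
      forall x y, exists s t, [/\ s < S, t < L & same_point N (f s t) (x, y)] &
      forall x y, exists s t, [/\ s < S, t < L &
        joins N (f s t) (f s t.+1) (x, y) (x, y.+1) ||
        joins N (f s t) (f s t.+1) (y, x) (y.+1, x)]].

Lemma eqmodI N i j a b : a + i * N = b + j * N -> a == b %[mod N].
Proof. by move=> E; rewrite -(modnMDl i a) addnC E addnC modnMDl. Qed.

Lemma same_point_refl N p : same_point N p p.
Proof. by rewrite /same_point !eqxx. Qed.

Lemma same_pointS N p q : same_point N p q ->
  same_point N (p.1.+1, p.2) (q.1.+1, q.2) /\ same_point N (p.1, p.2.+1) (q.1, q.2.+1).
Proof.
have S a b : a == b %[mod N] -> a.+1 == b.+1 %[mod N] by rewrite -(eqn_modDl 1).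
by case/andP=> H1 H2; rewrite /same_point /= H1 H2 !S.
Qed.

Section Long.
Variables (u M N : nat).
Hypotheses (u0 : 0 < u) (M0 : 0 < M) (NE : N = u * M).

(** In every period of [N] steps, [u] steps up are followed by [N - u] steps
    right, so that the direction depends only on the coordinate sum modulo [N].
    A period translates by [(-u, u)], so the walk closes after [M] periods. The
    transposed walks take the other direction at each vertex. *)
Definition long_walk s t :=
  (N - s + (t %/ N) * (N - u) + (t %% N - u), s + (t %/ N) * u + minn (t %% N) u).

Let N0 : 0 < N. Proof. by rewrite NE muln_gt0 u0. Qed.
Let uN : u <= N. Proof. by rewrite NE leq_pmulr. Qed.

Lemma long_walk_next s t : s < u ->
  long_walk s t.+1 = if t %% N < u then ((long_walk s t).1, (long_walk s t).2.+1)
                     else ((long_walk s t).1.+1, (long_walk s t).2).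
Proof.
move=> su; rewrite (divn_eq t N) /long_walk.
move: (t %/ N) (t %% N) (ltn_pmod t N0) => q r rN.
rewrite -addnS !divnMDl // !modnMDl (divn_small rN) (modn_small rN) addn0.
move: uN N0; move: N rN => K rK uK K0.
have [rK'|] := ltnP r.+1 K.
  rewrite (divn_small rK') (modn_small rK') addn0.
  by move: (q * (K - u)) (q * u) => A B; case: ltnP => ru; congr (_, _) => /=; lia.
move=> Kr; have -> : K = r.+1 by lia.
rewrite divnn modnn /= addn1 !mulSn.
move: (q * (r.+1 - u)) (q * u) => A B; case: ltnP => ru; congr (_, _) => /=; lia.
Qed.

Lemma long_walk_time q k : q < M -> q * N + k %% N < N * M.
Proof.
move=> qM; apply: (@leq_trans (q.+1 * N)); first by rewrite mulSn addnC ltn_add2r ltn_pmod.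
by rewrite mulnC leq_mul2l qM orbT.
Qed.

(** Walking back from [(x, y)] to the start of a period gives a point with
    second coordinate [z]. The periods of the walk [s] start at the second
    coordinates congruent to [s] modulo [u]. *)
Lemma long_walk_hits x y : exists s q, [/\ s < u, q < M &
  same_point N (long_walk s (q * N + (x + y) %% N)) (x, y)].
Proof.
set r := (x + y) %% N; have rN : r < N := ltn_pmod _ N0.
pose z := (y + N - minn r u) %% N; have zN : z < N := ltn_pmod _ N0.
exists (z %% u), (z %/ u); split; first exact: ltn_pmod.
  by rewrite ltn_divLR // mulnC -NE.
have zE := divn_eq z u; move: (ltn_pmod z u0) zE; set s := z %% u; set q := z %/ u => su zE.
rewrite /long_walk divnMDl // modnMDl (divn_small rN) (modn_small rN) addn0.
have mr : minn r u <= r := geq_minl _ _.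
have Ey : s + q * u + minn r u = y %[mod N].
  have -> : s + q * u = z by rewrite addnC.
  by rewrite /z modnDml subnK ?modnDr //; lia.
apply/andP; split=> /=; last by apply/eqP.
rewrite -(eqn_modDr (s + q * u + minn r u)).
have -> : (x + (s + q * u + minn r u)) %% N = r by rewrite -modnDmr Ey modnDmr.
have -> : N - s + q * (N - u) + (r - u) + (s + q * u + minn r u) = q.+1 * N + r.
  have : q * (N - u) + q * u = q * N by rewrite -mulnDr subnK.
  have sN : s <= N by apply: leq_trans uN; apply: ltnW.
  have rE : r - u + minn r u = r by rewrite minnE; clear; lia.
  by rewrite mulSn addnACA rE addnACA subnK // => ->.
by rewrite modnMDl (modn_small rN).
Qed.

Lemma long_half : half_decomposition N (N * M) u long_walk.
Proof.
split.
- by rewrite mulnCA -NE.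
- move=> s su; rewrite /long_walk mulKn // modnMr div0n mod0n !mul0n sub0n min0n !addn0.
  have sN : s <= N by apply: leq_trans uN; apply: ltnW.
  apply/andP; split=> /=.
    apply: (@eqmodI _ 1 M); have : M * (N - u) + N = M * N.
      by rewrite mulnBr [M * u]mulnC -NE subnK // leq_pmull.
    by move: sN; clear; lia.
  by apply: (@eqmodI _ 0 1); rewrite NE mulnC; clear; lia.
- move=> s t su _; rewrite (long_walk_next _ su); apply/orP; left; apply/orP.
  by case: ifP => _; [right|left]; apply: same_point_refl.
- move=> x y; have [s [q [su qM H]]] := long_walk_hits x y.
  exists s, (q * N + (x + y) %% N); split=> //.
  exact: long_walk_time.
move=> x y; have [ru|ru] := ltnP ((x + y) %% N) u.
  have [s [q [su qM H]]] := long_walk_hits x y.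
  exists s, (q * N + (x + y) %% N); split=> //.
    exact: long_walk_time.
  rewrite (long_walk_next _ su) modnMDl modn_mod ru /joins H /=.
  by have [_ ->] := same_pointS H.
have [s [q [su qM H]]] := long_walk_hits y x.
exists s, (q * N + (y + x) %% N); split=> //; first exact: long_walk_time.
rewrite addnC in ru.
rewrite (long_walk_next _ su) modnMDl modn_mod ltnNge ru /joins H /=.
by have [-> _] := same_pointS H; rewrite orbT.
Qed.

End Long.

Section Short.
Variables (m M N : nat).
Hypotheses (m0 : 0 < m) (M0 : 0 < M) (NE : N = 4 * m * M).

(** Staircases with two steps up, then two steps right. *)
Definition stair_x t := 2 * (t %/ 4) + (t %% 4 - 2).
Definition stair_y t := 2 * (t %/ 4) + minn (t %% 4) 2.
Definition stair (p : nat * nat) t := (p.1 + stair_x t, p.2 + stair_y t).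

Lemma stair_xD t : stair_x t + stair_y t = t.
Proof. by rewrite /stair_x /stair_y minnE; clear; lia. Qed.

Lemma odd_stair_x t : odd (stair_x t) = (t %% 4 == 3).
Proof. by rewrite /stair_x mul2n oddD odd_double; case: (t %% 4) (ltn_pmod t (isT : 0 < 4)) => [|[|[|[|]]]]. Qed.

Lemma stair_xS t : stair_x t.+1 = stair_x t + ~~ (t %% 4 < 2).
Proof. by rewrite /stair_x; case: ltnP => H; move: H; clear; lia. Qed.

Lemma stair_yS t : stair_y t.+1 = stair_y t + (t %% 4 < 2).
Proof. by rewrite /stair_y; case: ltnP => H; move: H; clear; lia. Qed.

Lemma stair_y_gt0 t : 0 < t -> 0 < stair_y t.
Proof. by rewrite /stair_y; clear; lia. Qed.

(** A ladder from [p = (x, y)] with coordinate sum divisible by [4 * m]: up along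
    the staircase of [p], from [(x, y + 1)] on for [4 * m - 1] steps, across to
    the staircase of [(x + 1, y - 1)], and down along it to [(x + 1, y + 1)].
    The rungs are horizontal edges of the unit squares at [p] and at
    [p + (2 * m, 2 * m)]; the vertical edges of these squares are cut out of
    both staircases, and they are covered by the rungs of transposed ladders. *)
Definition ladder (p : nat * nat) t :=
  if t %% (8 * m) < 4 * m then stair p (t %% (8 * m)).+1
  else let q := stair p (8 * m + 1 - t %% (8 * m)) in (q.1.+1, q.2.-1).

(** The base points [p] of the ladders: [x] even and [4 * m] divides [x + y]. *)
Definition ladder_base i :=
  let x := 2 * (i %/ M) in (x, 4 * m * (i %% M) + (N - x)).

Lemma ladder_up p t : t < 4 * m -> ladder p t = stair p t.+1.
Proof.
move=> tm; have t8 : t < 8 * m by lia.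
by rewrite /ladder modn_small // tm.
Qed.

Lemma ladder_down p t : 2 <= t <= (4 * m).+1 ->
  ladder p (8 * m + 1 - t) = ((stair p t).1.+1, (stair p t).2.-1).
Proof.
move=> tm; have t8 : 8 * m + 1 - t < 8 * m by lia.
rewrite /ladder modn_small // ltnNge.
have -> : 4 * m <= 8 * m + 1 - t by lia.
by have -> : 8 * m + 1 - (8 * m + 1 - t) = t by lia.
Qed.

Lemma ladder_close p : ladder p (8 * m) = ladder p 0.
Proof. by rewrite /ladder modnn mod0n. Qed.

Lemma ladder_base_hits X Y : ~~ odd X -> 4 * m %| X + Y ->
  exists2 i, i < 2 * m * M * M & same_point N (ladder_base i) (X, Y).
Proof.
have N0 : 0 < N by rewrite NE !muln_gt0 m0.
move=> oX dXY.
have XN : X %% N < N := ltn_pmod _ N0.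
have SN : (X + Y) %% N < N := ltn_pmod _ N0.
have dS : 4 * m %| (X + Y) %% N.
  by rewrite -(dvdn_addr _ (_ : 4 * m %| (X + Y) %/ N * N)) -?divn_eq // NE dvdn_mull // dvdn_mulr.
have oN : ~~ odd N by rewrite NE !oddM.
have oXN : ~~ odd (X %% N).
  by move: oX; rewrite {1}(divn_eq X N) oddD oddM (negPf oN) andbF.
set k := (X + Y) %% N %/ (4 * m).
have kM : k < M by rewrite ltn_divLR ?muln_gt0 // mulnC -NE.
exists ((X %% N)./2 * M + k).
  apply: (@leq_trans ((X %% N)./2.+1 * M)); first by rewrite mulSn addnC ltn_add2r.
  by rewrite leq_mul2r ltn_half_double -mul2n !mulnA -NE XN orbT.
rewrite /ladder_base divnMDl // modnMDl (divn_small kM) (modn_small kM) addn0.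
have -> : 2 * (X %% N)./2 = X %% N by rewrite mul2n even_halfK.
rewrite /same_point /= modn_mod eqxx /= mulnC divnK //.
rewrite -(eqn_modDl (X %% N)) addnCA subnKC ?(ltnW XN) // modnDr modn_mod.
by rewrite modnDml.
Qed.

Lemma walk_hits x y a b : x + y = a + b %[mod 4 * m] -> a <= 2 * N -> b <= 2 * N ->
  odd x = odd a -> exists2 i, i < 2 * m * M * M &
    same_point N ((ladder_base i).1 + a, (ladder_base i).2 + b) (x, y).
Proof.
move=> /eqP xy aN bN oxa.
(* The summands [2 * N] keep the subtractions from truncating. *)
have [||i iS /andP[/= H1 H2]] := @ladder_base_hits (x + 2 * N - a) (y + 2 * N - b).
- rewrite oddB; last by move: aN; clear; lia.
  by rewrite oddD oxa mul2n odd_double addbF addbb.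
- have -> : x + 2 * N - a + (y + 2 * N - b) = x + y + 4 * N - (a + b) by move: aN bN; clear; lia.
  rewrite -eqn_mod_dvd; last by move: aN bN; clear; lia.
  have -> : 4 * N = 4 * M * (4 * m) by rewrite NE; clear; lia.
  by rewrite addnC modnMDl.
exists i => //; apply/andP; split=> /=.
  rewrite -(eqn_modDr a) subnK in H1; last by move: aN; clear; lia.
  by rewrite (eqP H1) addnC modnMDl.
rewrite -(eqn_modDr b) subnK in H2; last by move: bN; clear; lia.
by rewrite (eqP H2) addnC modnMDl.
Qed.

Let mN : 4 * m <= N. Proof. by rewrite NE leq_pmulr. Qed.

Lemma stair_hits x y t : x + y = t %[mod 4 * m] -> t <= (4 * m).+1 ->
  odd x = (t %% 4 == 3) ->
  exists2 i, i < 2 * m * M * M & same_point N (stair (ladder_base i) t) (x, y).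
Proof.
move=> xy tm ox; apply: walk_hits; rewrite ?stair_xD ?odd_stair_x //.
  by move: (stair_xD t) mN tm m0; clear; lia.
by move: (stair_xD t) mN tm m0; clear; lia.
Qed.

Lemma stair_hits_down x y t : x + y = t %[mod 4 * m] -> 2 <= t <= (4 * m).+1 ->
  odd x = (t %% 4 != 3) ->
  exists2 i, i < 2 * m * M * M & same_point N (ladder (ladder_base i) (8 * m + 1 - t)) (x, y).
Proof.
move=> xy tm ox; have /andP[t2 tm'] := tm.
have y0 : 0 < stair_y t by apply: stair_y_gt0; apply: leq_trans t2.
have [||||i iS H] := @walk_hits x y (stair_x t).+1 (stair_y t).-1.
- by rewrite addSn -addnS prednK // stair_xD.
- by move: (stair_xD t) mN tm' m0 y0; clear; lia.
- by move: (stair_xD t) mN tm' m0 y0; clear; lia.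
- by rewrite ox /= odd_stair_x.
exists i => //; rewrite ladder_down //= -addnS.
by have -> : ((ladder_base i).2 + stair_y t).-1 = (ladder_base i).2 + (stair_y t).-1 by move: y0; clear; lia.
Qed.

Lemma joins_sym p q a b : joins N p q a b = joins N q p a b.
Proof. by rewrite /joins orbC ![same_point N q _ && _]andbC. Qed.

(** The direction in which the staircases leave [(x, y)] depends on its
    coordinate sum; the two excluded cases are the edges cut out of them. *)
Lemma ladder_edge x y : let d := (x + y) %% (4 * m) in
  ~~ ((d == 0) && ~~ odd x) -> ~~ ((d == 1) && odd x) ->
  exists i t, [/\ i < 2 * m * M * M, t < 8 * m &
    joins N (ladder (ladder_base i) t) (ladder (ladder_base i) t.+1) (x, y)
      (if d %% 4 < 2 then (x, y.+1) else (x.+1, y))].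
Proof.
move=> d not0 not1.
have dm : d < 4 * m by rewrite ltn_pmod ?muln_gt0.
have [ox|ox] := boolP (odd x == (d %% 4 == 3)).
  have d0 : 0 < d.
    by rewrite lt0n; apply: contra not0 => /eqP E; rewrite E /= (eqP ox) E.
  have [||i iS H] := @stair_hits x y d _ _ (eqP ox).
  - by rewrite modn_mod.
  - by apply: leq_trans (ltnW dm) _.
  exists i, d.-1; split=> //; first by move: dm; clear; lia.
  rewrite prednK // !ladder_up ?prednK //; last by apply: leq_trans dm; apply: leq_pred.
  rewrite /joins H /=; apply/orP; left.
  have [H1 H2] := same_pointS H.
  by rewrite /stair stair_xS stair_yS; case: (d %% 4 < 2); rewrite /= ?addn0 ?addn1 ?addnS.
have {}ox : odd x = (d %% 4 != 3) by move: ox; case: (odd x); case: (d %% 4 == 3).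
(* The way down covers the times from [2] to [4 * m + 1]. *)
pose t := if d == 0 then 4 * m else d.
have t4 : t %% 4 = d %% 4 by rewrite /t; case: eqP => // ->; rewrite modnMr.
have tm : 2 <= t <= 4 * m.
  rewrite /t; case: eqP => [d0|/eqP d0]; first by move: m0; clear; lia.
  rewrite (ltnW dm) andbT ltn_neqAle eq_sym lt0n d0 andbT.
  by apply: contra not1 => /eqP E; rewrite E ox E.
have [|||i iS H] := @stair_hits_down x y t.
- by rewrite /t; case: eqP => [E|_]; [rewrite modnn; exact: E | rewrite modn_mod].
- by move: tm; clear; lia.
- by rewrite t4.
exists i, (8 * m - t); split=> //; first by move: tm m0; clear; lia.
have -> : (8 * m - t).+1 = 8 * m + 1 - t by move: tm; clear; lia.
rewrite joins_sym /joins H /=; apply/orP; left.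
have -> : 8 * m - t = 8 * m + 1 - t.+1 by move: tm; clear; lia.
rewrite ladder_down; last by move: tm; clear; lia.
rewrite ladder_down in H; last by move: tm; clear; lia.
have [H1 H2] := same_pointS H.
have y0 : 0 < stair_y t by apply: stair_y_gt0; case/andP: tm => /ltnW.
have sy0 : 0 < (ladder_base i).2 + stair_y t by rewrite ltn_addl.
rewrite /stair /= stair_xS stair_yS t4; move: H1 H2; rewrite /= prednK //.
by case: (d %% 4 < 2); rewrite /= ?addn0 ?addn1 ?addnS.
Qed.

Lemma stair_step p t : torus_step N (stair p t) (stair p t.+1).
Proof.
rewrite /torus_step /stair stair_xS stair_yS.
by case: (t %% 4 < 2); rewrite /= ?addn0 ?addn1 ?addnS same_point_refl ?orbT.
Qed.

Lemma ladder_far_rung p : ladder p (4 * m) = ((ladder p (4 * m).-1).1.+1, (ladder p (4 * m).-1).2).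
Proof.
have m4 : 0 < 4 * m by rewrite muln_gt0.
have {1}-> : 4 * m = 8 * m + 1 - (4 * m).+1 by clear; lia.
rewrite ladder_down; last by move: m0; clear; lia.
rewrite ladder_up ?prednK // /stair stair_xS stair_yS modnMr /= addn0 addn1.
by rewrite addnS.
Qed.

Lemma ladder_near_rung p : ladder p (8 * m).-1 = ((ladder p 0).1.+1, (ladder p 0).2).
Proof.
have -> : (8 * m).-1 = 8 * m + 1 - 2 by move: m0; clear; lia.
rewrite ladder_down; last by move: m0; clear; lia.
by rewrite ladder_up ?muln_gt0 //= addn2 addn1.
Qed.

Lemma ladder_step p t : t < 8 * m -> torus_edge N (ladder p t) (ladder p t.+1).
Proof.
move=> t8; have [tm|] := ltnP t.+1 (4 * m).
  by rewrite !ladder_up ?(ltnW tm) // /torus_edge stair_step.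
rewrite leq_eqVlt => /orP[/eqP E|tm].
  have -> : t = (4 * m).-1 by rewrite E.
  rewrite prednK ?muln_gt0 // ladder_far_rung.
  by rewrite /torus_edge /torus_step same_point_refl.
have [t8'|] := ltnP t.+1 (8 * m); last first.
  move=> t8'; have -> : t = (8 * m).-1 by move: t8 t8'; clear; lia.
  rewrite prednK ?muln_gt0 // ladder_close ladder_near_rung.
  by rewrite /torus_edge /torus_step same_point_refl !orbT.
pose t' := 8 * m - t.
have -> : t.+1 = 8 * m + 1 - t' by move: t8; rewrite /t'; clear; lia.
have -> : t = 8 * m + 1 - t'.+1 by move: t8; rewrite /t'; clear; lia.
have tt' : 2 <= t' <= 4 * m by move: t8' tm; rewrite /t'; clear; lia.
rewrite !ladder_down; try by move: tt'; clear; lia.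
have y0 : 0 < stair_y t' by apply: stair_y_gt0; case/andP: tt' => /ltnW.
rewrite /torus_edge; apply/orP; right; rewrite /torus_step /stair stair_xS stair_yS /=.
have sy0 : 0 < p.2 + stair_y t' by rewrite ltn_addl.
rewrite prednK //.
by case: (t' %% 4 < 2); rewrite /= ?addn0 ?addn1 ?addnS same_point_refl ?orbT.
Qed.

Lemma short_half : half_decomposition N (8 * m) (2 * m * M * M) (fun i => ladder (ladder_base i)).
Proof.
have m4 : 0 < 4 * m by rewrite muln_gt0.
have m48 : 4 * m < 8 * m by move: m0; clear; lia.
have mod4 x y : (x + y) %% (4 * m) %% 4 = (x + y) %% 4 by rewrite modn_dvdm // dvdn_mulr.
split.
- by rewrite NE; clear; lia.
- by move=> i _; rewrite ladder_close same_point_refl.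
- by move=> i t _; apply: ladder_step.
- move=> x y; pose d := (x + y) %% (4 * m).
  have dm : d < 4 * m by rewrite ltn_mod.
  have [E|ne] := eqVneq (odd x) (d %% 4 == 3).
    pose t := if d == 0 then 4 * m else d.
    have tm : 0 < t <= 4 * m.
      by rewrite /t; case: eqP => [_|/eqP d0]; rewrite ?m4 ?leqnn // lt0n d0 ltnW.
    have [|||i iS H] := @stair_hits x y t.
    + by rewrite /t; case: eqP => [H|_]; [rewrite modnn; exact: H | rewrite modn_mod].
    + by case/andP: tm => _; apply: leqW.
    + by rewrite E /t; case: (d =P 0) => // ->; rewrite modnMr.
    exists i, t.-1; case/andP: tm => t0 tm; split=> //.
      by rewrite prednK // (leq_trans tm) // ltnW.
    by rewrite ladder_up prednK.
  have {}ne : odd x = (d %% 4 != 3) by move: ne; case: (odd x); case: (_ == 3).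
  pose t := if d < 2 then 4 * m + d else d.
  have tm : 2 <= t <= (4 * m).+1.
    by rewrite /t; case: (ltnP d 2) => H; move: H dm m0; clear; lia.
  have [|||i iS H] := @stair_hits_down x y t.
  + by rewrite /t; case: ifP => _; rewrite ?modnDl modn_mod.
  + by [].
  + by rewrite ne /t; case: ifP => // _; rewrite mulnC -modnDml modnMl.
  by exists i, (8 * m + 1 - t); split=> //; move: tm; clear; lia.
move=> x y; set d := (x + y) %% (4 * m).
have [d4|d4] := ltnP (d %% 4) 2; last first.
  have := @ladder_edge y x; rewrite /= [y + x]addnC -/d ltnNge d4 /= => -[||i [t [iS t8 H]]].
  - by apply: contraL d4 => /andP[/eqP-> _].
  - by apply: contraL d4 => /andP[/eqP-> _].
  by exists i, t; split=> //; rewrite H orbT.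
have [/andP[d0 ox]|not0] := boolP ((d == 0) && ~~ odd x).
  have [|||i iS H] := @stair_hits y x (4 * m).
  - by rewrite addnC -/d modnn; apply/eqP.
  - exact: leqnSn.
  - move: (mod4 x y) ox; rewrite -/d (eqP d0) modnMr /=; clear; lia.
  exists i, (4 * m).-1; split=> //; first by rewrite prednK // ltnW.
  rewrite prednK // ladder_far_rung ladder_up ?prednK // /joins H /=.
  by have [-> _] := same_pointS H; rewrite orbT.
have [/andP[d1 ox]|not1] := boolP ((d == 1) && odd x).
  have [|||i iS H] := @stair_hits y x 1.
  - by rewrite addnC -/d modn_small ?(eqP d1) //; move: m0; clear; lia.
  - by [].
  - move: (mod4 x y) ox; rewrite -/d (eqP d1) /=; clear; lia.
  exists i, (8 * m).-1; split=> //; first by rewrite prednK // muln_gt0.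
  rewrite prednK ?muln_gt0 // ladder_close ladder_near_rung ladder_up // /joins H /=.
  by have [-> _] := same_pointS H; rewrite !orbT.
have := @ladder_edge x y not0 not1; rewrite /= -/d d4 => -[i [t [iS t8 H]]].
by exists i, t; split=> //; rewrite H.
Qed.

End Short.

Section Squares.
Variables (M N : nat).
Hypotheses (M0 : 0 < M) (NE : N = 2 * M).

(** The unit squares whose lower left corner has an even first and an odd second
    coordinate. *)
Definition square i t :=
  let x := 2 * (i %/ M) in let y := 2 * (i %% M) + 1 in
  nth (x, y) [:: (x, y); (x.+1, y); (x.+1, y.+1); (x, y.+1)] t.

Lemma square_hits X Y : ~~ odd X -> odd Y ->
  exists2 i, i < M * M &
   [/\ same_point N (square i 0) (X, Y), same_point N (square i 1) (X.+1, Y),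
       same_point N (square i 2) (X.+1, Y.+1) & same_point N (square i 3) (X, Y.+1)].
Proof.
move=> oX oY.
suff [i iM H0] : exists2 i, i < M * M & same_point N (square i 0) (X, Y).
  exists i => //; have [H1 H3] := same_pointS H0; have [_ H2] := same_pointS H1.
  by split.
 have N0 : 0 < N by rewrite NE muln_gt0.
have half Z : (Z %% N)./2 < M by rewrite ltn_half_double -mul2n -NE ltn_mod.
have oN Z : odd (Z %% N) = odd Z.
  by rewrite {2}(divn_eq Z N) oddD oddM NE mul2n odd_double andbF.
exists ((X %% N)./2 * M + (Y %% N)./2).
  apply: (@leq_trans ((X %% N)./2.+1 * M)); first by rewrite mulSn addnC ltn_add2r.
  by rewrite leq_mul2r half orbT.
rewrite /square /= divnMDl // modnMDl (divn_small (half Y)) (modn_small (half Y)) addn0.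
rewrite /same_point /= !mul2n even_halfK ?oN // modn_mod eqxx /=.
by have := odd_double_half (Y %% N); rewrite oN oY addnC => ->; rewrite modn_mod.
Qed.

Lemma squares_half : half_decomposition N 4 (M * M) square.
Proof.
have per x y : same_point N (x + N, y + N) (x, y) by rewrite /same_point !modnDr !eqxx.
have N0 : 0 < N by rewrite NE muln_gt0.
split.
- by rewrite NE; clear; lia.
- by move=> i _; apply: same_point_refl.
- move=> i t _; rewrite /torus_edge /torus_step.
  by case: t => [|[|[|[|//]]]] _; rewrite /= same_point_refl ?orbT.
- move=> x y; suff [i [t [iM t4 H]]] : exists i t,
      [/\ i < M * M, t < 4 & same_point N (square i t) (x + N, y + N)].
    exists i, t; split=> //; move: H (per x y) => /andP[/= /eqP E1 /eqP E2].
    by rewrite /same_point /= E1 E2.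
  have xN : 0 < x + N by rewrite addn_gt0 N0 orbT.
  have yN : 0 < y + N by rewrite addn_gt0 N0 orbT.
  have [ox|ox] := boolP (odd (x + N)); have [oy|oy] := boolP (odd (y + N)).
  + have [|i iM [_ H _ _]] := @square_hits (x + N).-1 (y + N) _ oy.
      by rewrite -oddS prednK // ox.
    by exists i, 1; rewrite prednK // in H.
  + have [||i iM [_ _ H _]] := @square_hits (x + N).-1 (y + N).-1.
    * by rewrite -oddS prednK // ox.
    * by rewrite -[odd _]negbK -oddS prednK.
    by exists i, 2; rewrite !prednK // in H.
  + have [i iM [H _ _ _]] := @square_hits (x + N) (y + N) ox oy.
    by exists i, 0.
  have [|i iM [_ _ _ H]] := @square_hits (x + N) (y + N).-1 ox.
    by rewrite -[odd _]negbK -oddS prednK.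
  by exists i, 3; rewrite prednK // in H.
move=> x y.
have [oy|oy] := boolP (odd y).
  have [ox|ox] := boolP (odd x).
    have x0 : 0 < x by case: x ox.
    have [|i iM [_ H1 H2 _]] := @square_hits x.-1 y _ oy; first by rewrite -oddS prednK ?ox.
    by exists i, 1; split=> //; rewrite /joins; rewrite !prednK // in H1 H2; rewrite H1 H2.
  have [i iM [H0 _ _ H3]] := @square_hits x y ox oy.
  by exists i, 3; split=> //; rewrite /joins H3 -[square i 4]/(square i 0) H0 orbT.
have [ox|ox] := boolP (odd x).
  have [i iM [H0 H1 _ _]] := @square_hits y x oy ox.
  by exists i, 0; split=> //; rewrite /joins H0 H1 orbT.
have xN : 0 < x + N by rewrite addn_gt0 N0 orbT.
have [|i iM [_ _ H2 H3]] := @square_hits y (x + N).-1 oy.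
  by rewrite -[odd _]negbK -oddS prednK // oddD NE mul2n odd_double addbF.
exists i, 2; split=> //; rewrite !prednK // /same_point modnDr in H2 H3.
by rewrite /joins /same_point H2 H3 !orbT.
Qed.

End Squares.

Lemma half_decomposition_exists k b : 2 <= b <= 4 * k ->
  exists S f, half_decomposition (2 ^ (2 * k)) (2 ^ b) S f.
Proof.
case/andP=> b2 b4; have pow0 n : 0 < 2 ^ n by rewrite expn_gt0.
have [bk|bk] := leqP (2 * k) b.
  exists (2 ^ (4 * k - b)), (long_walk (2 ^ (4 * k - b)) (2 ^ (2 * k))).
  have -> : 2 ^ b = 2 ^ (2 * k) * 2 ^ (b - 2 * k) by rewrite -expnD subnKC.
  apply: long_half => //; rewrite -expnD; congr (2 ^ _).
  by move: b4 bk; clear; lia.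
have [b3|b3] := ltnP 2 b.
  have -> : 2 ^ b = 8 * 2 ^ (b - 3) by rewrite -[8]/(2 ^ 3) -expnD subnKC.
  eexists; eexists; apply: (@short_half _ (2 ^ (2 * k - b + 1))) => //.
  rewrite -[4]/(2 ^ 2) -!expnD; congr (2 ^ _); move: b3 bk; clear; lia.
have -> : b = 2 by move: b2 b3; clear; lia.
eexists; eexists; apply: (@squares_half (2 ^ (2 * k).-1)) => //.
rewrite -expnS prednK //; move: b2 bk; clear; lia.
Qed.

(** * Coverings with the right number of cycles are decompositions *)

Section Counting.
Variables (V : finType) (e : rel V).
Hypothesis e_irr : irreflexive e.

Lemma cycle_cycle_edge (c : seq V) : cycle (cycle_edge c) c.
Proof.
have pp (z : V) s : path (path_edge z s) z s.
  elim: s z => //= w s IH z; rewrite same_edge_refl /=.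
  by apply: sub_path (IH w) => x y ->; rewrite orbT.
by case: c => // z c; rewrite (cycle_path z); apply: pp (last z c) (z :: c).
Qed.

Lemma cycle_edges_size (c : seq V) : #|cycle_edges c| <= size c.
Proof. by apply: leq_trans (leq_imset_card _ _) _; apply: card_size. Qed.

Lemma cycle_edges_sub (c : seq V) : subrel (cycle_edge c) e -> cycle_edges c \subset edge_set e.
Proof.
move=> sub; apply/subsetP=> _ /imsetP[x xc ->].
apply/imsetP; exists (x, next c x) => //; rewrite inE /=; apply: sub.
by apply: next_cycle; first exact: cycle_cycle_edge.
Qed.

Lemma mem_cycle_edges (c : seq V) x y : uniq c -> subrel (cycle_edge c) e ->
  cycle_edge c x y -> [set x; y] \in cycle_edges c.
Proof.
move=> uc sub cxy; have exy := sub _ _ cxy.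
pose R u v := (next c u == v) || (next c v == u).
have sR : symmetric R by move=> u v; rewrite /R orbC.
have cR : cycle R c by apply: sub_cycle (cycle_next uc) => u v /= uv; rewrite /R uv.
have xy : x != y by apply: contraTneq exy => ->; rewrite e_irr.
have nin u v : u != v -> next c u = v -> u \in c.
  by move=> uv E; apply: contraR uv => uc'; rewrite -E next_nth (negPf uc').
case/orP: (cycle_edge_sub sR cR cxy) => /eqP E; apply/imsetP.
  by exists x; rewrite ?E // (nin x y).
by exists y; rewrite ?E 1?setUC // (nin y x) // eq_sym.
Qed.

(** The cycles have at most [size cs * L] edges in all, so if they cover at least
    that many edges, then no edge is covered twice and no cycle is repeated. *)
Lemma decomposes_by_counting (cs : seq (seq V)) L : 2 < L ->
  (forall c, c \in cs -> [/\ uniq c, size c = L & subrel (cycle_edge c) e]) ->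
  (forall x y, e x y -> has (fun c => cycle_edge c x y) cs) ->
  size cs * L <= #|edge_set e| ->
  decomposes_into_cycles e (size cs) L.
Proof.
move=> L2 Hcs cov le.
pose D : {set {set {set V}}} := [set:: map (@cycle_edges V) cs].
have coverD : cover D = edge_set e.
  apply/eqP; rewrite eqEsubset; apply/andP; split.
    apply/bigcupsP=> C; rewrite inE => /mapP[c /Hcs[_ _ sub] ->].
    exact: cycle_edges_sub.
  apply/subsetP=> _ /imsetP[[x y] exy ->]; rewrite inE /= in exy.
  have /hasP[c cc cxy] := cov _ _ exy; have [uc _ sub] := Hcs _ cc.
  apply/bigcupP; exists (cycle_edges c); last exact: mem_cycle_edges.
  by rewrite inE map_f.
have DL C : C \in D -> #|C| <= L.
  by rewrite inE => /mapP[c /Hcs[_ <- _] ->]; apply: cycle_edges_size.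
have cD : #|D| <= size cs.
  by rewrite cardsE -(size_map (@cycle_edges V)) card_size.
have sumD : \sum_(C in D) #|C| <= #|D| * L.
  by rewrite -sum_nat_const; apply: leq_sum.
have [leD eqD] := leq_card_cover D.
have L_gt0 : 0 < L by apply: leq_trans L2.
have E1 : #|edge_set e| <= #|D| * L by rewrite -coverD; apply: leq_trans sumD.
have cardD : #|D| = size cs.
  by apply/eqP; rewrite eqn_leq cD -(leq_pmul2r L_gt0) (leq_trans le).
exists D; split=> //.
  rewrite /partition coverD eqxx /=; apply/andP; split.
    rewrite -eqD eqn_leq leD coverD; apply: leq_trans le.
    by rewrite -cardD.
  rewrite inE; apply/mapP=> -[c /Hcs[_ sc _] E].
  case: c sc E => [|x c] sc E; first by rewrite -sc in L_gt0.
  have : [set x; next (x :: c) x] \in cycle_edges (x :: c) by apply: imset_f; rewrite mem_head.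
  by rewrite -E inE.
move=> C; rewrite inE => /mapP[c /Hcs[uc sc sub] ->]; exists c; split=> //.
- by rewrite sc.
- by rewrite /ucycle uc andbT; apply: sub_cycle (cycle_cycle_edge c).
Qed.

End Counting.

(** An edge is determined by the direction it changes and its end that has a
    zero there; half of the pairs of a vertex and a direction are of this kind. *)
Lemma hypercube_edges n : n * 2 ^ n <= 2 * #|edge_set (@hypercube n)|.
Proof.
pose V := {ffun 'I_n -> bool}.
pose flip (p : V * 'I_n) : V := [ffun j => p.1 j (+) (j == p.2)].
have flipE u i j : flip (u, i) j = u j (+) (j == i) by rewrite ffunE.
have flipK u i : flip (flip (u, i), i) = u by apply/ffunP=> j; rewrite !flipE addbK.
pose A := [set p : V * 'I_n | ~~ p.1 p.2].
have cA : 2 * #|A| = n * 2 ^ n.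
  have -> : n * 2 ^ n = #|{: V * 'I_n}|.
    by rewrite card_prod card_ffun card_bool !card_ord mulnC.
  rewrite -(cardsC A) mul2n -addnn; congr (_ + _).
  have inj : injective (fun p : V * 'I_n => (flip p, p.2)).
    by move=> [u i] [v j] /= [E Eij]; rewrite Eij in E *; rewrite -[u](flipK u j) E flipK.
  rewrite -(card_imset (mem A) inj); apply: eq_card => -[u i]; rewrite !inE /= negbK.
  apply/imsetP/idP=> [[[v j]]|ui].
    by rewrite inE /= => vj [-> ->]; rewrite flipE eqxx addbT.
  by exists (flip (u, i), i); rewrite ?inE /= ?flipE ?eqxx ?ui ?flipK.
rewrite -cA leq_mul2l /=.
have inj : {in A &, injective (fun p : V * 'I_n => [set p.1; flip p])}.
  move=> [u i] [v j]; rewrite !inE /= => ui vj E.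
  have flipN w k : flip (w, k) != w.
    by apply/eqP=> /ffunP/(_ k); rewrite flipE eqxx addbT; case: (w k).
  have idx w : flip (w, i) = flip (w, j) -> i = j.
    by move=> /ffunP/(_ i); rewrite !flipE eqxx; case: eqP => //; case: (w i).
  have : v \in [set u; flip (u, i)] by rewrite E !inE eqxx.
  rewrite !inE => /orP[/eqP Evu|/eqP Evu].
    subst v; have : flip (u, i) \in [set u; flip (u, j)] by rewrite -E !inE eqxx orbT.
    by rewrite !inE (negPf (flipN u i)) => /eqP/idx ->.
  have : u \in [set v; flip (v, j)] by rewrite -E !inE eqxx.
  rewrite !inE Evu eq_sym (negPf (flipN u i)) /= => /eqP/ffunP/(_ i).
  rewrite !flipE eqxx; case: eqP => [Eij|]; last by case: (u i).
  by move: vj; rewrite Evu flipE -Eij eqxx addbT negbK (negPf ui).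
rewrite -(card_in_imset inj); apply/subset_leq_card/subsetP=> _ /imsetP[[u i] _ ->].
apply/imsetP; exists (u, flip (u, i)) => //; rewrite inE /= /hypercube.
apply/eqP; rewrite -(cards1 i); apply: eq_card => j; rewrite !inE flipE.
by case: (u j); case: (j == i).
Qed.

(** * Tori in the square of a Hamiltonian-decomposable graph *)

Section Tori.
Variables (T : finType) (e : rel T) (x0 : T) (cs : seq (seq T)).
Variables (L S : nat) (f : nat -> nat -> nat * nat).
Hypotheses (e_sym : symmetric e) (csP : hamiltonian_decomposition e cs).
Hypotheses (L_gt0 : 0 < L) (fP : half_decomposition #|T| L S f).
Let N := #|T|.

(** The Boolean [b] tells a walk ([true]) from its transpose. *)
Definition torus_point (c : seq T) (b : bool) (p : nat * nat) : T * T :=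
  if b then (cnth x0 c p.1, cnth x0 c p.2) else (cnth x0 c p.2, cnth x0 c p.1).

Definition torus_cycle c b s := mkseq (fun t => torus_point c b (f s t)) L.

Definition torus_cycles :=
  [seq torus_cycle p.1 p.2 s | p <- [seq (c, b) | c <- cs, b <- [:: true; false]], s <- iota 0 S].

Lemma size_torus_cycles : size torus_cycles = 2 * size cs * S.
Proof. by rewrite !size_allpairs size_iota /= [2 * _]mulnC. Qed.

Lemma torus_cyclesP d : d \in torus_cycles ->
  exists c b s, [/\ c \in cs, s < S & d = torus_cycle c b s].
Proof.
case/allpairsP=> -[[c b] s] [/allpairsP[[c' b'] [/= cc _ [-> ->]]] /=].
by rewrite mem_iota => sS ->; exists c', b', s.
Qed.

Lemma torus_cycle_mem c b s : c \in cs -> s < S -> torus_cycle c b s \in torus_cycles.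
Proof.
move=> cc sS; apply/allpairsP; exists ((c, b), s); split=> //; last by rewrite mem_iota.
by apply/allpairsP; exists (c, b); split=> //; case: (b).
Qed.

Lemma torus_point_same c b p q : hamiltonian e c -> same_point N p q ->
  torus_point c b p = torus_point c b q.
Proof.
case=> _ sc _ /andP[/eqP E1 /eqP E2]; rewrite /torus_point.
by rewrite !(@cnth_mod _ x0 c p.1 q.1) ?(@cnth_mod _ x0 c p.2 q.2) // sc.
Qed.

Lemma torus_cycle_edge c b s x y : hamiltonian e c -> s < S ->
  cycle_edge (torus_cycle c b s) x y =
  has (fun t => same_edge (torus_point c b (f s t)) (torus_point c b (f s t.+1)) x y) (iota 0 L).
Proof.
move=> hc sS; have [_ close _ _ _] := fP.
by rewrite cycle_edge_mkseq //; apply: torus_point_same; rewrite ?close.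
Qed.

Lemma torus_cycle_valid c b s : hamiltonian e c -> s < S ->
  subrel (cycle_edge (torus_cycle c b s)) (cart e e).
Proof.
move=> hc sS x y; have [_ _ step _ _] := fP; have [_ sc ec] := hc.
rewrite torus_cycle_edge // => /hasP[t]; rewrite mem_iota /= add0n => tL.
have w0 : 0 < size c by rewrite sc; apply/card_gt0P; exists x0.
have st p q : torus_step N p q -> cart e e (torus_point c b p) (torus_point c b q).
  by case/orP=> /(torus_point_same b hc) <-; rewrite /torus_point /cart;
    case: b; rewrite /= (ec _ _ (cnth_step x0 w0 _)) eqxx ?orbT.
apply: same_edgeP; first exact: cart_sym.
by case/orP: (step _ _ sS tL) => /st // H; rewrite cart_sym.
Qed.

Lemma torus_cycle_uniq c b s : hamiltonian e c -> s < S -> uniq (torus_cycle c b s).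
Proof.
move=> hc sS; have [SL _ _ hit _] := fP; have [uc sc _] := hc.
have cT x : x \in c := hamiltonian_mem x hc.
pose all := flatten [seq torus_cycle c b s | s <- iota 0 S].
have szall : size all = S * L.
  rewrite size_flatten /shape -map_comp (eq_map (_ : _ =1 fun=> L)); last by move=> ?; apply: size_mkseq.
  by rewrite sumnE big_map big_const_seq count_predT size_iota iter_addn_0 mulnC.
have uall : uniq all.
  apply: (@leq_size_uniq _ (enum {: T * T})).
  - exact: enum_uniq.
  - move=> [x y] _.
    have [i iN ->] := cnthP x0 (cT x); have [j jN ->] := cnthP x0 (cT y).
    have [s' [t [s'S tL H]]] := hit (if b then i else j) (if b then j else i).
    apply/flattenP; exists (torus_cycle c b s'); first by rewrite map_f // mem_iota.
    apply/mapP; exists t; first by rewrite mem_iota.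
    by rewrite (torus_point_same b hc H) /torus_point; case: b {all szall H}.
  - by rewrite -cardE szall SL card_prod.
have : torus_cycle c b s \in [seq torus_cycle c b s | s <- iota 0 S] by rewrite map_f // mem_iota.
move: uall; rewrite /all; elim: [seq _ | _ <- _] => //= a l IH.
by rewrite cat_uniq inE => /and3P[ua _ ul] /orP[/eqP->|/IH->].
Qed.

Lemma torus_cycles_cover p q : cart e e p q -> has (fun c => cycle_edge c p q) torus_cycles.
Proof.
have [ham cov] := csP; have [_ _ _ _ edge] := fP.
have found c b s t : c \in cs -> s < S -> t < L ->
    same_edge (torus_point c b (f s t)) (torus_point c b (f s t.+1)) p q ->
    has (fun c => cycle_edge c p q) torus_cycles.
  move=> cc sS tL H; apply/hasP; exists (torus_cycle c b s); first exact: torus_cycle_mem.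
  by rewrite torus_cycle_edge; [apply/hasP; exists t; rewrite ?mem_iota | exact: ham |].
have joined c b s t a a' : c \in cs -> s < S -> t < L -> joins N (f s t) (f s t.+1) a a' ->
    same_edge (torus_point c b a) (torus_point c b a') p q ->
    has (fun c => cycle_edge c p q) torus_cycles.
  move=> cc sS tL H E; apply: (@found c b s t) => //; have hc := ham _ cc.
  by case/orP: H => /andP[/(torus_point_same b hc) -> /(torus_point_same b hc) ->] //;
    rewrite same_edgeC.
have at_all c : c \in cs -> forall x, exists i, x = cnth x0 c i.
  by move=> /ham hc x; have /(cnthP x0)[i _ ->] := hamiltonian_mem x hc; exists i.
move: p q found joined => [x x'] [y y'] found joined /orP[]/andP[/=].
  move=> /cov/hasP[c cc /(cnth_edgeP x0)[i _ xy]] /eqP Exy.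
  have [j Ej] := at_all c cc x'; have [s [t [sS tL /orP[]]]] := edge j i => H.
    apply: (joined c false s t _ _ cc sS tL H).
    by move: xy; rewrite /same_edge !xpair_eqE -Exy Ej !eqxx !andbT.
  apply: (joined c true s t _ _ cc sS tL H).
  by move: xy; rewrite /same_edge !xpair_eqE -Exy Ej !eqxx !andbT.
move=> /eqP Exy /cov/hasP[c cc /(cnth_edgeP x0)[i _ xy]].
have [j Ej] := at_all c cc x; have [s [t [sS tL /orP[]]]] := edge j i => H.
  apply: (joined c true s t _ _ cc sS tL H).
  by move: xy; rewrite /same_edge !xpair_eqE -Exy Ej !eqxx.
apply: (joined c false s t _ _ cc sS tL H).
by move: xy; rewrite /same_edge !xpair_eqE -Exy Ej !eqxx.
Qed.

End Tori.

Theorem hypercube_decomposition k b : 0 < k -> 2 <= b <= 4 * k ->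
  decomposes_into_cycles (@hypercube (4 * k)) (2 * k * 2 ^ (4 * k - b)) (2 ^ b).
Proof.
move=> k0 bk; have [T [e [cs [es iso szcs csP]]]] := cube_hamiltonian_decomposition k0.
have cT := card_cube iso.
have [S [f]] := half_decomposition_exists bk; rewrite -cT => fP.
have : cube_iso (cart e e) (4 * k).
  by have := cube_iso_cart iso iso; rewrite -mulnDl.
case=> g [g' gK g'K] gE.
have /card_gt0P[x0 _] : 0 < #|T| by rewrite cT expn_gt0.
have L2 : 2 < 2 ^ b by rewrite (@leq_trans (2 ^ 2)) ?leq_exp2l //; case/andP: bk.
pose ds := map (map g) (torus_cycles x0 cs (2 ^ b) S f).
have SE : S = 2 ^ (4 * k - b).
  have [SL _ _ _ _] := fP; apply/eqP; rewrite -(eqn_pmul2r (_ : 0 < 2 ^ b)) ?expn_gt0 //.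
  rewrite SL cT -!expnD; apply/eqP; congr (2 ^ _); case/andP: bk; clear; lia.
have <- : size ds = 2 * k * 2 ^ (4 * k - b).
  by rewrite size_map size_torus_cycles szcs SE.
have [ham _] := csP.
apply: decomposes_by_counting => //.
- exact: hypercube_irrefl.
- move=> d /mapP[d' /torus_cyclesP[c [b' [s [cc sS ->]]]] ->]; split.
  + by rewrite (map_inj_uniq (can_inj gK)); apply: (torus_cycle_uniq _ fP) => //; apply: ham.
  + by rewrite size_map size_mkseq.
  + move=> u v; rewrite -[u]g'K -[v]g'K cycle_edge_map; last exact: can_inj gK.
    by rewrite gE; apply: (torus_cycle_valid _ fP) => //; apply: ham.
- move=> u v; rewrite -[u]g'K -[v]g'K gE => /(torus_cycles_cover x0 csP fP) /hasP[d dd duv].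
  apply/hasP; exists (map g d); first exact: map_f.
  by rewrite cycle_edge_map //; apply: can_inj gK.
rewrite -(leq_pmul2l (isT : 0 < 2)); apply: leq_trans (hypercube_edges _).
rewrite size_map size_torus_cycles szcs -mulnA; have [-> _ _ _ _] := fP.
by rewrite cT -expnD -mulnDl mulnA leq_mul // mulnA.
Qed.

Theorem corollary8 (n b beta : nat) (hn : 1 <= n) (hb : 2 <= b)
    (hb_even : ~~ odd b) (hbeta : 2 <= beta <= 2 * b * n) :
  decomposes_into_cycles (@hypercube (2 * b * n))
    (b * n * 2 ^ (2 * b * n - beta)) (2 ^ beta).
Proof.
have bE : b = 2 * b./2 by rewrite mul2n even_halfK.
have E : 2 * b * n = 4 * (b./2 * n) by rewrite {1}bE !mulnA.
have -> : b * n = 2 * (b./2 * n) by rewrite {1}bE mulnA.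
rewrite E in hbeta *; apply: hypercube_decomposition => //.
by rewrite muln_gt0 hn andbT half_gt0.
Qed.
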